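(* Let $A$ and $B$ be positive definite operators on a Hilbert space $H$. For $p,r>0$, $t\geqslant 0$ and any integer $n\geqslant 1$ such that $(p+t)s+r=(n+1)(t+r)$, the following assertions are equivalent. (D1) $A\gg B$. (D2) $A^{t+r}\geqslant \left(A^{r/2}(A^{t/2}B^{p}A^{t/2})^{s}A^{r/2}\right)^{\frac{1}{n+1}}$. (D3) $\left(B^{r/2}(B^{t/2}A^{p}B^{t/2})^{s}B^{r/2}\right)^{\frac{1}{n+1}}\geqslant B^{t+r}$. (D4) There exists a unique $T>0$ with $\|T\|\leqslant 1$ such that $$B^{p}=A^{-\frac t2}\left(A^{\frac t2}(TA^{t+r})^{n}TA^{\frac t2}\right)^{\frac1s}A^{-\frac t2}=A^{-\frac t2}\left(A^{\frac t2}T(A^{t+r}T)^{n}A^{\frac t2}\right)^{\frac1s}A^{-\frac t2}.$$ (D5) There exists a unique $T>0$ with $\|T\|\leqslant 1$ such that $$A^{p}=B^{-\frac t2}\left(B^{\frac t2}(T^{-1}B^{t+r})^{n}T^{-1}B^{\frac t2}\right)^{\frac1s}B^{-\frac t2}=B^{-\frac t2}\left(B^{\frac t2}T^{-1}(B^{t+r}T^{-1})^{n}B^{\frac t2}\right)^{\frac1s}B^{-\frac t2}.$$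
   Context: Operators are bounded linear operators on a Hilbert space $H$. An operator $X$ is positive, $X\geqslant 0$, if $\langle Xx,x\rangle\geqslant 0$ for all $x\in H$; $X\geqslant Y$ means that $X,Y$ are self-adjoint and $X-Y\geqslant 0$. $X>0$ means that $X$ is positive definite (positive and invertible). Real powers of positive definite operators are taken by the continuous functional calculus, and $\log X=\lim_{a\to +0}\frac{X^{a}-I}{a}$ for $X>0$. The chaotic operator order $A\gg B$ means $\log A\geqslant \log B$. $\|\cdot\|$ is the operator norm. *)

(* Defs.v *)
From HB Require Import structures.
From mathcomp Require Import all_boot all_order all_algebra.
From mathcomp Require Import complex.
From mathcomp Require Import all_classical all_reals all_analysis.

Set Implicit Arguments.
Unset Strict Implicit.
Unset Printing Implicit Defensive.

Import Order.TTheory GRing.Theory Num.Theory.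
Import numFieldNormedType.Exports.

Local Open Scope classical_set_scope.
Local Open Scope complex_scope.
Local Open Scope ring_scope.

(* The scalars are complex: [positive] below makes no mention of
   self-adjointness, which is automatic only over the complex numbers.  The
   form [inner] is linear in its first argument and conjugate-linear in its
   second one. *)
HB.mixin Record CompleteNormedModule_isHilbert (R : realType) H
    of CompleteNormedModule R[i] H := {
  inner : {dot H for @Num.conj R[i]} ;
  normr_inner : forall x : H, `|x| ^+ 2 = inner x x
}.

#[short(type="hilbertType")]
HB.structure Definition Hilbert (R : realType) :=
  {H of CompleteNormedModule_isHilbert R H & CompleteNormedModule R[i] H}.

Section BoundedOperator.
Context {R : realType} {H : hilbertType R}.

Record operator := Operator {
  operator_fun :> H -> H ;
  operator_linear : linear operator_fun ;
  operator_bounded : exists M, forall x, `|operator_fun x| <= M * `|x|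
}.

HB.instance Definition _ (T : operator) :=
  GRing.isLinear.Build R[i] H H *:%R (operator_fun T) (operator_linear T).

Lemma operatorP (S T : operator) : (forall x, S x = T x) -> S = T.
Proof.
case: S T => [S lS bS] [T lT bT] /= /funext ST.
by subst T; congr Operator; exact: Prop_irrelevance.
Qed.

HB.instance Definition _ := gen_eqMixin operator.
HB.instance Definition _ := gen_choiceMixin operator.

Lemma op0_bounded : exists M, forall x : H, `|\0 x : H| <= M * `|x|.
Proof. by exists 0 => x; rewrite normr0 mul0r. Qed.

Lemma op0_linear : linear (\0 : H -> H).
Proof. by move=> a x y; rewrite scaler0 addr0. Qed.

Definition op0 : operator := Operator op0_linear op0_bounded.

Lemma opopp_linear (T : operator) : linear (\- T).
Proof. by move=> a x y /=; rewrite linearP opprD scalerN. Qed.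

Lemma opopp_bounded (T : operator) :
  exists M, forall x : H, `|(\- T) x| <= M * `|x|.
Proof. by case: (operator_bounded T) => M TM; exists M => x; rewrite normrN. Qed.

Definition opopp (T : operator) : operator :=
  Operator (opopp_linear T) (opopp_bounded T).

Lemma opadd_linear (S T : operator) : linear (S \+ T).
Proof. by move=> a x y /=; rewrite !linearP scalerDr addrACA. Qed.

Lemma opadd_bounded (S T : operator) :
  exists M, forall x : H, `|(S \+ T) x| <= M * `|x|.
Proof.
case: (operator_bounded S) (operator_bounded T) => M SM [N TN].
by exists (M + N) => x; rewrite mulrDl (le_trans (ler_normD _ _))// lerD.
Qed.

Definition opadd (S T : operator) : operator :=
  Operator (opadd_linear S T) (opadd_bounded S T).

Lemma opscale_linear (a : R[i]) (T : operator) : linear (a \*: T).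
Proof. by move=> b x y /=; rewrite linearP scalerDr !scalerA mulrC. Qed.

Lemma opscale_bounded (a : R[i]) (T : operator) :
  exists M, forall x : H, `|(a \*: T) x| <= M * `|x|.
Proof.
case: (operator_bounded T) => M TM; exists (`|a| * M) => x.
by rewrite /= normrZ -mulrA ler_wpM2l.
Qed.

Definition opscale (a : R[i]) (T : operator) : operator :=
  Operator (opscale_linear a T) (opscale_bounded a T).

Lemma op1_linear : linear (@idfun H).
Proof. by []. Qed.

Lemma op1_bounded : exists M, forall x : H, `|idfun x| <= M * `|x|.
Proof. by exists 1 => x; rewrite mul1r. Qed.

Definition op1 : operator := Operator op1_linear op1_bounded.

Lemma opmul_linear (S T : operator) : linear (S \o T).
Proof. by move=> a x y /=; rewrite !linearP. Qed.

Lemma opmul_bounded (S T : operator) :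
  exists M, forall x : H, `|(S \o T) x| <= M * `|x|.
Proof.
case: (operator_bounded S) (operator_bounded T) => M SM [N TN].
exists (`|M| * N) => x /=; rewrite -mulrA.
have : 0 <= M * `|T x| by rewrite (le_trans _ (SM _)).
move=> /ger0_norm MT; rewrite (le_trans (SM _))// -MT normrM normr_id.
by rewrite ler_wpM2l.
Qed.

Definition opmul (S T : operator) : operator :=
  Operator (opmul_linear S T) (opmul_bounded S T).

Lemma opaddA : associative opadd.
Proof. by move=> S T U; apply: operatorP => x /=; rewrite addrA. Qed.
Lemma opaddC : commutative opadd.
Proof. by move=> S T; apply: operatorP => x /=; rewrite addrC. Qed.
Lemma opadd0 : left_id op0 opadd.
Proof. by move=> T; apply: operatorP => x /=; rewrite add0r. Qed.
Lemma opaddN : left_inverse op0 opopp opadd.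
Proof. by move=> T; apply: operatorP => x /=; rewrite addNr. Qed.

HB.instance Definition _ :=
  GRing.isZmodule.Build operator opaddA opaddC opadd0 opaddN.

Lemma opmulA : associative opmul.
Proof. by move=> S T U; apply: operatorP. Qed.
Lemma opmul1l : left_id op1 opmul.
Proof. by move=> T; apply: operatorP. Qed.
Lemma opmul1r : right_id op1 opmul.
Proof. by move=> T; apply: operatorP. Qed.
Lemma opmulDl : left_distributive opmul opadd.
Proof. by move=> S T U; apply: operatorP. Qed.
Lemma opmulDr : right_distributive opmul opadd.
Proof. by move=> S T U; apply: operatorP => x /=; rewrite linearD. Qed.

(* Not a [nzRingType]: H may be the zero space. *)
HB.instance Definition _ := GRing.Zmodule_isPzRing.Build operator
  opmulA opmul1l opmul1r opmulDl opmulDr.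

Lemma opscaleA (a b : R[i]) (T : operator) :
  opscale a (opscale b T) = opscale (a * b) T.
Proof. by apply: operatorP => x /=; rewrite scalerA. Qed.
Lemma opscale1 : left_id 1 opscale.
Proof. by move=> T; apply: operatorP => x /=; rewrite scale1r. Qed.
Lemma opscaleDr : right_distributive opscale +%R.
Proof. by move=> a S T; apply: operatorP => x /=; rewrite scalerDr. Qed.
Lemma opscaleDl (T : operator) : {morph opscale^~ T : a b / a + b}.
Proof. by move=> a b; apply: operatorP => x /=; rewrite scalerDl. Qed.

HB.instance Definition _ := GRing.Zmodule_isLmodule.Build R[i] operator
  opscaleA opscale1 opscaleDr opscaleDl.

End BoundedOperator.
Arguments operator {R} H.

Section OperatorTheory.
Context {R : realType} {H : hilbertType R}.
Implicit Types (S T X Y L : operator H).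

Definition opnorm T : R :=
  sup [set complex.Re `|T x| | x in [set x : H | `|x| <= 1]].

Definition selfadjoint T := forall x y : H, inner (T x) y = inner x (T y).

(* In the order of R[i], [0 <= z] says that z is real and nonnegative. *)
Definition positive T := forall x : H, 0 <= inner (T x) x.

Definition op_ge X Y := [/\ selfadjoint X, selfadjoint Y & positive (X - Y)].

Definition is_inverse T S := S * T = 1 /\ T * S = 1.

Definition invertible T := exists S, is_inverse T S.

(* Junk value 0 if T is not invertible. *)
Definition opinv T : operator H := xget 0 (is_inverse T).

Definition posdef T := positive T /\ invertible T.

Definition spectrum T : set R[i] := 
  [set z | ~ invertible (z *: (1 : operator H) - T)].

Definition op_horner (p : {poly R}) T : operator H :=
  \sum_(i < size p) (p`_i)%:C *: T ^+ i.

(* Continuous functional calculus f(T) of a self-adjoint T: the limit in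
   operator norm of p_k(T) for polynomials p_k converging to f uniformly on the
   spectrum of T, which is then a compact subset of the real line.  Such p_k
   exist when f is continuous on the spectrum (Weierstrass), and the limit does
   not depend on their choice because |p(T)| is the supremum of |p| on the
   spectrum. *)
Definition is_cfc (f : R -> R) T X := exists p : nat -> {poly R},
  {uniform [set x : R | spectrum T x%:C], (fun k => horner (p k)) @ \oo --> f}
  /\ opnorm (op_horner (p k) T - X) @[k --> \oo] --> (0 : R).

Definition cfc (f : R -> R) T : operator H := xget 0 (is_cfc f T).

Definition op_power T (a : R) : operator H := cfc (fun x => x `^ a) T.

Definition is_op_log T L :=
  opnorm ((a^-1)%:C *: (op_power T a - 1) - L) @[a --> 0^'+] --> (0 : R).

Definition op_log T : operator H := xget 0 (is_op_log T).

Definition chaotic_ge X Y := op_ge (op_log X) (op_log Y).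

End OperatorTheory.

Definition exponents {R : realType} (n : nat) (p r t s : R) :=
  [/\ 0 < p, 0 < r, 0 <= t & (p + t) * s + r = n.+1%:R * (t + r)].

Notation "X `^^ a" := (op_power X a) (at level 11) : ring_scope.

(* Main.v *)
(* Functional calculus: for self-adjoint T and a real polynomial p that is
   nonnegative on the spectrum of T, the infimum m of the numerical range of
   p(T) makes p(T) - m non-invertible, so factoring p - m over the complex
   numbers puts a root of p - m in the spectrum, and m >= 0.  Hence |p(T)| is
   bounded by the supremum of |p| on the spectrum, which with Bernstein
   approximation gives existence and uniqueness of the limit that defines f(T).

   (D1) -> (D2): if log A >= log B then A' = exp(e) A satisfies A'^h >= B^h for
   small h > 0; the Furuta inequality for A'^h and B^h, followed by
   Loewner-Heinz and e -> 0, gives A^r >= (A^(r/2) B^p A^(r/2))^(r/(p+r)).  With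
   r := t this compares A^t and (A^(t/2) B^p A^(t/2))^(t/(p+t)), and a second
   use of the Furuta inequality yields (D2).
   (D2) -> (D1): with t = 0, s = 1 and p = n r, Bernoulli's inequality bounds
   (n+1)(A^r - 1) below by 1 - A^(-r/2) B^(-nr) A^(-r/2); divide by r -> 0.
   (D3) for (A, B) is (D2) for (B^-1, A^-1).  Conjugating by
   V = A^((t+r)/2) turns the equation of (D4) into
   V T V = (A^(r/2) (A^(t/2) B^p A^(t/2))^s A^(r/2))^(1/(n+1)), so T exists, is
   unique, and is at most 1 exactly when (D2) holds; (D5) is the same with T^-1
   and (D3). *)

Require Import Defs.
From HB Require Import structures.
From mathcomp Require Import all_boot all_order all_algebra.
From mathcomp Require Import complex ring lra.
From mathcomp Require Import all_classical all_reals all_analysis.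

Set Implicit Arguments.
Unset Strict Implicit.
Unset Printing Implicit Defensive.

Import Order.TTheory GRing.Theory Num.Theory.
Import numFieldNormedType.Exports.
Local Open Scope classical_set_scope.
Local Open Scope complex_scope.
Local Open Scope ring_scope.

Reserved Notation "c %:O" (at level 1, format "c %:O").
Local Notation "c %:O" := (c%:C *: (1 : operator _) : operator _)
  : ring_scope.

(** * Polynomial approximation *)

(** Once the calculus is set up, the spectrum disappears from the argument: an operator is
    controlled by two constants with m <= T <= M, and a function by uniform polynomial
    approximability on [m, M]. One interval can then serve two operators at once, and facts about
    f(T) are facts about polynomials plus an error bound. Loewner-Heinz rests on the exponents c
    with A^c >= B^c being closed under midpoints; dyadic exponents and norm continuity of the powers
    do the rest. Logarithms enter only through T^h = 1 + h log T + O(h^2) with an explicit constant.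
    The hypothesis log A >= log B compares first-order terms only, so it does not by itself dominate
    the quadratic remainders; the factor exp(e) supplies a first-order margin that absorbs them, and
    it is removed after all exponents have become independent of h. The space H may be zero, where
    norms vanish while lower bounds are arbitrary; this is why many constants carry an added 1 or a
    maximum. *)

Section Approximation.
Context {R : realType}.
Implicit Types (a c e m M t x y L : R) (f : R -> R) (g : nat -> R).

Definition polynomially_approximable m M f :=
  forall e, 0 < e -> exists p : {poly R},
    forall x, m <= x <= M -> `|p.[x] - f x| <= e.

(* The Bernstein polynomial \sum_k g k 'C(n, k) s^k (1 - s)^(n - k), by its
   recursion in n. *)
Fixpoint bernstein (s : {poly R}) n g : {poly R} :=
  if n is n'.+1 then
    (1 - s) * bernstein s n' g + s * bernstein s n' (g \o succn)
  else (g 0)%:P.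

(** The bracket on the right is the second moment about [y] of a binomial variable: squared bias
    plus variance. The centre [y] stays general because passing to the shifted samples [g \o succn]
    moves it to [y - 1]. *)
Lemma bernstein_error s n g c y (al be : R) x : 0 <= s.[x] <= 1 ->
  (forall k, (k <= n)%N -> `|g k - c| <= al + be * (k%:R - y) ^+ 2) ->
  `|(bernstein s n g).[x] - c| <=
    al + be * ((n%:R * s.[x] - y) ^+ 2 + n%:R * s.[x] * (1 - s.[x])).
Proof.
move=> /andP[t0 t1]; elim: n g y => [|n IH] g y gc /=.
  by rewrite hornerC; have := gc 0 (leqnn _); rewrite !mul0r addr0.
rewrite !hornerE /=; move: s.[x] t0 t1 IH => t t0 t1 IH.
have h1 := IH _ _ (fun k (kn : (k <= n)%N) => gc k (leqW kn)).
have h2 : `|(bernstein s n (g \o succn)).[x] - c| <=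
    al + be * ((n%:R * t - (y - 1)) ^+ 2 + n%:R * t * (1 - t)).
  apply: IH => k kn /=.
  have -> : k%:R - (y - 1) = k.+1%:R - y by rewrite -natr1; ring.
  exact: gc.
set u := (bernstein s n g).[x] in h1 *.
set v := (bernstein s n (g \o succn)).[x] in h2 *.
have -> : (1 - t) * u + t * v - c = (1 - t) * (u - c) + t * (v - c) by ring.
apply: le_trans (ler_normD _ _) _; rewrite !normrM (ger0_norm t0).
rewrite [`|1 - t|]ger0_norm ?subr_ge0//.
have t1' : 0 <= 1 - t by rewrite subr_ge0.
apply: le_trans (lerD (ler_wpM2l t1' h1) (ler_wpM2l t0 h2)) _.
by rewrite -natr1 le_eqVlt; apply/orP; left; apply/eqP; ring.
Qed.

(** The inequality |u| <= d + u^2 / d turns the Lipschitz bound at the nodes into the quadratic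
    bound that [bernstein_error] accepts. *)
Lemma Lipschitz_approximable m M f L : 0 <= L ->
  (forall x y, m <= x <= M -> m <= y <= M -> `|f x - f y| <= L * `|x - y|) ->
  polynomially_approximable m M f.
Proof.
move=> L0 fL e e0; have [Mm|mM] := leP M m.
  exists (f m)%:P => x /andP[mx xM]; rewrite hornerC.
  have -> : x = m by apply: le_anti; rewrite mx andbT (le_trans xM).
  by rewrite subrr normr0 ltW.
pose w := M - m; have w0 : 0 < w by rewrite subr_gt0.
(* This makes L d at most e / 2; the number [n] of nodes chosen below does the same for the variance
   term. *)
pose d := e / (2 * (L + 1)).
have L1 : 0 < L + 1 by lra.
have d0 : 0 < d by rewrite divr_gt0// mulr_gt0.
have e20 : 0 < e / 2 by lra.
have [n n0 nB] : exists2 n : nat, 0 < n%:R :> R &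
    L * w ^+ 2 / d / (e / 2) <= n%:R.
  exists (Num.bound (L * w ^+ 2 / d / (e / 2))).+1; first by rewrite ltr0n.
  apply: le_trans (ltW (archi_boundP _)) _; last by rewrite ler_nat.
  by rewrite !divr_ge0 ?mulr_ge0 ?exprn_ge0 // ltW.
pose s := w^-1 *: ('X - m%:P) : {poly R}.
exists (bernstein s n (fun k => f (m + w * (k%:R / n%:R)))) => x /andP[mx xM].
have sx : s.[x] = (x - m) / w by rewrite hornerZ hornerXsubC mulrC.
have sx01 : 0 <= s.[x] <= 1.
  rewrite sx divr_ge0 ?(ltW w0) ?subr_ge0 ?(ltW mM)//= ler_pdivrMr// mul1r /w.
  by rewrite lerD2r.
have main k : (k <= n)%N -> `|f (m + w * (k%:R / n%:R)) - f x| <=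
    L * d + L * w ^+ 2 / (n%:R ^+ 2 * d) * (k%:R - n%:R * s.[x]) ^+ 2.
  move=> kn; set z := m + _.
  have kn1 : 0 <= (k%:R / n%:R : R) <= 1.
    by rewrite divr_ge0 ?ler0n//= ler_pdivrMr// mul1r ler_nat.
  have zmM : m <= z <= M.
    case/andP: kn1 => h1 h2; rewrite /z lerDl mulr_ge0 ?(ltW w0)//=.
    have -> : M = m + w * 1 by rewrite /w; ring.
    by rewrite lerD2l ler_wpM2l ?(ltW w0).
  apply: le_trans (fL _ _ zmM _) _; first by rewrite mx.
  have -> : L * d + L * w ^+ 2 / (n%:R ^+ 2 * d) * (k%:R - n%:R * s.[x]) ^+ 2 =
      L * (d + (z - x) ^+ 2 / d).
    by rewrite sx /z; field; rewrite !gt_eqF.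
  rewrite ler_wpM2l// -(ler_pM2r d0) mulrDl divfK ?gt_eqF//.
  rewrite -[in leRHS]real_normK ?num_real//.
  by have := sqr_ge0 (`|z - x| - d); have := normr_ge0 (z - x); nra.
apply: le_trans (bernstein_error sx01 main) _.
rewrite subrr expr0n add0r.
have h : s.[x] * (1 - s.[x]) <= 1 by case/andP: sx01 => h1 h2; nra.
apply: le_trans (_ : L * d + L * w ^+ 2 / (n%:R ^+ 2 * d) * n%:R <= _).
  rewrite lerD2l; apply: ler_wpM2l; last by rewrite -mulrA ler_piMr ?ler0n.
  by apply: divr_ge0; apply: mulr_ge0; rewrite ?exprn_ge0 ?ler0n//; exact: ltW.
have h1 : L * d <= e / 2.
  rewrite /d mulrA ler_pdivrMr ?mulr_gt0//; nra.
have h2 : L * w ^+ 2 / (n%:R ^+ 2 * d) * n%:R <= e / 2.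
  have -> : L * w ^+ 2 / (n%:R ^+ 2 * d) * n%:R = L * w ^+ 2 / d / n%:R.
    by field; rewrite !gt_eqF.
  by move: nB; rewrite !ler_pdivrMr// [n%:R * _]mulrC.
lra.
Qed.

Lemma ln_Lipschitz m M x y : 0 < m -> m <= x <= M -> m <= y <= M ->
  `|ln x - ln y| <= m^-1 * `|x - y|.
Proof.
move=> m0; have h u v : m <= u -> m <= v -> u <= v ->
    0 <= ln v - ln u <= m^-1 * (v - u).
  move=> mu mv uv; have u0 : 0 < u by lra.
  have v0 : 0 < v by lra.
  rewrite subr_ge0 ler_ln ?posrE// uv/= -ln_div ?posrE//.
  have -> : v / u = 1 + (v - u) / u by field; rewrite gt_eqF.
  apply: le_trans (le_ln1Dx _) _.
    apply: lt_le_trans (_ : 0 <= _); rewrite ?ltrN10 ?divr_ge0 ?subr_ge0//.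
    exact: ltW.
  by rewrite mulrC ler_wpM2r ?subr_ge0// lef_pV2 ?posrE.
move=> /andP[mx _] /andP[my _]; have [xy|yx] := leP x y.
  have /andP[h1 h2] := h _ _ mx my xy.
  by rewrite distrC (distrC x) !ger0_norm// subr_ge0.
have /andP[h1 h2] := h _ _ my mx (ltW yx).
by rewrite !ger0_norm// subr_ge0 ltW.
Qed.

Lemma expR_Lipschitz c x y : x <= c -> y <= c ->
  `|expR x - expR y| <= expR c * `|x - y|.
Proof.
have h u v : u <= v -> v <= c -> 0 <= expR v - expR u <= expR c * (v - u).
  move=> uv vc; rewrite subr_ge0 ler_expR uv/=.
  have := expR_ge1Dx (u - v); have := expR_gt0 v => v0.
  have : expR u = expR v * expR (u - v) by rewrite -expRD addrC subrK.
  move=> -> h; have hc : expR v <= expR c by rewrite ler_expR.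
  nra.
have [xy|yx] := leP x y => xc yc.
  have /andP[h1 h2] := h _ _ xy yc.
  by rewrite distrC (distrC x) !ger0_norm// subr_ge0.
have /andP[h1 h2] := h _ _ (ltW yx) xc.
by rewrite !ger0_norm// subr_ge0 ltW.
Qed.

Lemma ln_approximable m M : 0 < m -> polynomially_approximable m M (@ln R).
Proof.
move=> m0; apply: (@Lipschitz_approximable _ _ _ m^-1).
  by rewrite invr_ge0 ltW.
by move=> x y; exact: ln_Lipschitz.
Qed.

Lemma powR_approximable m M a : 0 < m ->
  polynomially_approximable m M (fun x => x `^ a).
Proof.
move=> m0.
(* An upper bound of a ln x on the interval, whatever the sign of a; on it exp has Lipschitz
   constant [expR c]. *)
pose c := `|a| * (`|ln m| + `|ln M|).
apply: (@Lipschitz_approximable _ _ _ (expR c * (`|a| * m^-1))).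
  by rewrite !mulr_ge0 ?expR_ge0// invr_ge0 ltW.
move=> x y mx my.
have bd z : m <= z <= M -> a * ln z <= c.
  move=> /andP[mz zM]; apply: le_trans (ler_norm _) _; rewrite normrM.
  apply: ler_wpM2l => //; have z0 : 0 < z by lra.
  have h1 : ln m <= ln z by rewrite ler_ln ?posrE.
  have h2 : ln z <= ln M by rewrite ler_ln ?posrE//; lra.
  rewrite ler_norml; apply/andP.
  have := ler_norm (- ln m); have := ler_norm (ln M); rewrite normrN.
  by have := normr_ge0 (ln m); have := normr_ge0 (ln M); split; lra.
have pE z : m <= z <= M -> z `^ a = expR (a * ln z).
  by move=> /andP[mz _]; rewrite /powR gt_eqF//; lra.
rewrite !pE//; apply: le_trans (expR_Lipschitz (bd _ mx) (bd _ my)) _.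
rewrite -mulrA ler_wpM2l ?expR_ge0// -mulrBr normrM -mulrA ler_wpM2l//.
exact: (@ln_Lipschitz _ M).
Qed.

(** From exp(-x) >= 1 - x one gets exp(x) (1 - x) <= 1, so the remainder is at most x^2 / (1 - x),
    and 1 - x >= 1/2. *)
Lemma expR_taylor2 x : x <= 2^-1 -> `|expR x - 1 - x| <= 2 * x ^+ 2.
Proof.
move=> x1; have h1 := expR_ge1Dx x; have h2 := expR_ge1Dx (- x).
have h3 : expR x * expR (- x) = 1 by rewrite -expRD subrr expR0.
have := expR_gt0 x => x0.
rewrite ger0_norm; last by lra.
have h4 : expR x * (1 - x) <= 1 by nra.
nra.
Qed.

End Approximation.

(** * Hilbert space and operator norm *)

Section Hilbert.
Context {R : realType} {H : hilbertType R}.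
Implicit Types (x y z : H) (c : R)
  (S T X Y : operator H).

(** Real parts bring all estimates into the ordered field [R], within reach of [lra] and [nra].
    Nothing is lost: [inner_ip] recovers the imaginary part from ['i%C *: y]. *)
Definition ip x y : R := complex.Re (inner x y).
Definition nrm x : R := complex.Re `|x|.

Lemma normr_nrm x : `|x| = (nrm x)%:C.
Proof. by rewrite /nrm RRe_real// normr_real. Qed.

Lemma nrm_ge0 x : 0 <= nrm x.
Proof. by rewrite -ler0c -normr_nrm normr_ge0. Qed.

Lemma nrm0 : nrm 0 = 0.
Proof. by rewrite /nrm normr0. Qed.

Lemma nrm_eq0 x : nrm x = 0 -> x = 0.
Proof. by move=> x0; apply/normr0_eq0; rewrite normr_nrm x0. Qed.

Lemma nrmD x y : nrm (x + y) <= nrm x + nrm y.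
Proof. by rewrite -lecR rmorphD/= -!normr_nrm ler_normD. Qed.

Lemma nrmZ c x : nrm (c%:C *: x) = `|c| * nrm x.
Proof.
apply: (@complexI R); rewrite rmorphM/= -!normr_nrm normrZ; congr (_ * _).
by rewrite normc_def/= expr0n/= addr0 sqrtr_sqr.
Qed.

Lemma nrmN x : nrm (- x) = nrm x.
Proof. by rewrite /nrm normrN. Qed.

Lemma nrmB x y : nrm (x - y) = nrm (y - x).
Proof. by rewrite -nrmN opprB. Qed.

Lemma innerC x y : inner x y = conjc (inner y x).
Proof. by have := hermC inner x y; rewrite expr0 mul1r. Qed.

Lemma innerZl (a : R[i]) x z : inner (a *: x) z = a * inner x z.
Proof. exact: linearZl_LR. Qed.

Lemma innerZr (a : R[i]) x z : inner x (a *: z) = conjc a * inner x z.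
Proof. by rewrite innerC innerZl rmorphM/= -innerC. Qed.

Lemma ipC x y : ip x y = ip y x.
Proof. by rewrite /ip innerC; case: (inner y x). Qed.

Lemma innerDl x y z : inner (x + y) z = inner x z + inner y z.
Proof. exact: linearDl. Qed.

Lemma ipDl x y z : ip (x + y) z = ip x z + ip y z.
Proof. by rewrite /ip innerDl; case: (inner x z); case: (inner y z). Qed.

Lemma ipZl c x z : ip (c%:C *: x) z = c * ip x z.
Proof.
by rewrite /ip innerZl; case: (inner x z) => a b /=; rewrite mul0r subr0.
Qed.

Lemma ipNl x z : ip (- x) z = - ip x z.
Proof. by rewrite -scaleN1r -(rmorphN1 (real_complex R)) ipZl mulN1r. Qed.

Lemma ipBl x y z : ip (x - y) z = ip x z - ip y z.
Proof. by rewrite ipDl ipNl. Qed.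

Lemma ipDr x y z : ip z (x + y) = ip z x + ip z y.
Proof. by rewrite ipC ipDl !(ipC z). Qed.

Lemma ipZr c x z : ip z (c%:C *: x) = c * ip z x.
Proof. by rewrite ipC ipZl ipC. Qed.

Lemma ipNr x z : ip z (- x) = - ip z x.
Proof. by rewrite ipC ipNl ipC. Qed.

Definition ipE := (ipDl, ipDr, ipNl, ipNr, ipZl, ipZr).

Lemma ip_nrm x : ip x x = nrm x ^+ 2.
Proof.
by rewrite /ip -normr_inner normr_nrm -rmorphXn.
Qed.

Lemma ip_ge0 x : 0 <= ip x x.
Proof. by rewrite ip_nrm sqr_ge0. Qed.

Lemma ip_ii x y : ip ('i%C *: x) ('i%C *: y) = ip x y.
Proof.
rewrite /ip innerZl innerZr; case: (inner x y) => a b /=.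
by ring.
Qed.

Lemma inner_ip x y : inner x y = (ip x y +i* ip x ('i%C *: y))%C.
Proof.
rewrite /ip innerZr/=; case: (inner x y) => a b /=.
by rewrite mul0r sub0r mulN1r opprK.
Qed.

Lemma selfadjointP T :
  selfadjoint T <-> forall x y, ip (T x) y = ip x (T y).
Proof.
split=> [sT x y|sT x y]; first by rewrite /ip sT.
by rewrite !inner_ip sT -linearZ sT.
Qed.

(** That inner (T x) x is real means that T x is orthogonal to i x for [ip]. Polarizing this and
    then replacing x by i x yields the symmetry of T. *)
Lemma positiveP T :
  positive T <-> selfadjoint T /\ forall x, 0 <= ip (T x) x.
Proof.
split=> [pT|[sT pT] x]; last first.
  rewrite lecE; apply/andP; split; last exact: pT.
  have := innerC (T x) x; rewrite -sT => h.
  have : complex.Im (inner (T x) x) = - complex.Im (inner (T x) x).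
    by rewrite {1}h; case: (inner (T x) x).
  by move=> h1; apply/eqP => /=; lra.
split; last by move=> x; have := pT x; rewrite lecE => /andP[].
have im x : ip (T x) ('i%C *: x) = 0.
  by have := pT x; rewrite lecE inner_ip => /andP[/= /eqP].
have pol x y : ip (T x) ('i%C *: y) + ip (T y) ('i%C *: x) = 0.
  have := im (x + y); rewrite scalerDr linearD ipDl !ipDr !im; lra.
apply/selfadjointP => x y.
have := pol ('i%C *: x) y.
rewrite linearZ/= ip_ii scalerA.
have -> : 'i%C * 'i%C = -1 :> R[i] by rewrite -expr2 sqr_i.
rewrite scaleN1r ipNr [ip (T y) x]ipC; lra.
Qed.

Lemma CS_form T x y : positive T ->
  ip (T x) y ^+ 2 <= ip (T x) x * ip (T y) y.
Proof.
move=> /positiveP[/selfadjointP sT pT].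
have q c : 0 <= ip (T x) x + 2 * c * ip (T x) y + c ^+ 2 * ip (T y) y.
  have := pT (x + c%:C *: y); rewrite linearD linearZ/= !ipE.
  by rewrite [ip (T y) x]ipC -sT => h; apply: le_trans h _; rewrite expr2; lra.
have := pT y; rewrite le_eqVlt => /orP[/eqP y0|y0].
  rewrite -y0 in q *.
  move: (ip (T x) x) (ip (T x) y) q (pT x) => a b q a0.
  rewrite mulr0; have [->|b0] := eqVneq b 0; first by rewrite expr0n.
  (* When the quadratic coefficient vanishes, the form is affine in c; here it takes the value -1,
     which rules out b != 0. *)
  have := q (- (a + 1) / (2 * b)).
  rewrite mulr0 addr0.
  have -> : 2 * (- (a + 1) / (2 * b)) * b = - (a + 1) by field.
  lra.
move: (ip (T x) x) (ip (T x) y) (ip (T y) y) q y0 => a b d q y0.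
have := q (- b / d).
have -> : a + 2 * (- b / d) * b + (- b / d) ^+ 2 * d = (a * d - b ^+ 2) / d.
  by field; rewrite gt_eqF.
by rewrite pmulr_lge0 ?invr_gt0// subr_ge0.
Qed.


Lemma gt0_Re (e : R[i]) : 0 < e -> e = (complex.Re e)%:C /\ 0 < complex.Re e.
Proof.
by case: e => a b; rewrite ltcE/= => /andP[/eqP -> a0].
Qed.

Lemma hilbert_complete (u : nat -> H) :
  (forall e : R, 0 < e -> exists N, forall m n, (N <= m)%N -> (N <= n)%N ->
     nrm (u m - u n) <= e) ->
  exists l, forall e : R, 0 < e -> exists N, forall n, (N <= n)%N ->
     nrm (u n - l) <= e.
Proof.
move=> cu.
have cF : cauchy (u @ \oo).
  apply/cauchyP => e /gt0_Re[]; move: (complex.Re e) => r -> r0.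
  have r20 : 0 < r / 2 by lra.
  have [N uN] := cu _ r20.
  exists (u N); exists N => // n /= Nn.
  rewrite -ball_normE/= normr_nrm ltcR.
  by apply: le_lt_trans (uN N n _ Nn) _ => //; lra.
have /cauchy_cvgP/cvg_ex[l ul] := cF.
exists l => e e0.
have e0' : 0 < e%:C by rewrite ltcR.
have /cvgrPdist_le/(_ _ e0')[N _ uN] := ul.
by exists N => n Nn; rewrite nrmB -lecR -normr_nrm; exact: uN.
Qed.

Lemma nrmZC (a : R[i]) x : nrm (a *: x) = complex.Re `|a| * nrm x.
Proof.
apply: (@complexI R); by rewrite rmorphM/= -!normr_nrm normrZ.
Qed.

Lemma operator_nrm_bounded T :
  exists2 M : R, 0 <= M & forall x, nrm (T x) <= M * nrm x.
Proof.
have [M TM] := operator_bounded T.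
exists `|complex.Re M| => // x.
have := TM x; rewrite !normr_nrm lecE => /andP[_].
case: M {TM} => a b /=; rewrite mulr0 subr0 => h.
by apply: le_trans h _; rewrite ler_wpM2r ?nrm_ge0// ler_norm.
Qed.

Lemma opnorm_set T :
  [set complex.Re `|T x| | x in [set x : H | `|x| <= 1]] =
  [set nrm (T x) | x in [set x : H | nrm x <= 1]].
Proof.
apply/seteqP; split => r [x /= x1 <-]; exists x => //=.
  by rewrite -lecR -normr_nrm.
by rewrite normr_nrm lecR.
Qed.

Lemma opnorm_le T (M : R) :
  0 <= M -> (forall x, nrm (T x) <= M * nrm x) -> opnorm T <= M.
Proof.
move=> M0 TM; rewrite /opnorm opnorm_set; apply: ge_sup.
  by exists (nrm (T 0)); exists 0 => //=; rewrite nrm0 ler01.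
move=> _ [x /= x1 <-]; apply: le_trans (TM x) _.
by rewrite -[leRHS]mulr1 ler_wpM2l.
Qed.

Lemma opnormP T x : nrm (T x) <= opnorm T * nrm x.
Proof.
have ub y : nrm y <= 1 -> nrm (T y) <= opnorm T.
  move=> y1; rewrite /opnorm opnorm_set; apply: ub_le_sup; last by exists y.
  have [M M0 TM] := operator_nrm_bounded T.
  exists M => _ [z /= z1 <-]; apply: le_trans (TM z) _.
  by rewrite -[leRHS]mulr1 ler_wpM2l.
have [x0|x0] := eqVneq (nrm x) 0.
  by rewrite (nrm_eq0 x0) linear0 nrm0 mulr0.
have xp : 0 < nrm x by rewrite lt_neqAle eq_sym x0 nrm_ge0.
have := ub ((nrm x)^-1%:C *: x).
rewrite linearZ/= !nrmZ ger0_norm ?invr_ge0 ?nrm_ge0// mulVf// => /(_ (lexx _)).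
by rewrite mulrC ler_pdivrMr.
Qed.

Lemma opnorm_ge0 T : 0 <= opnorm T.
Proof.
have := opnormP T 0; rewrite nrm0 mulr0 linear0 nrm0 => _.
rewrite /opnorm opnorm_set; apply: ub_le_sup; last first.
  by exists 0; rewrite /= ?linear0 ?nrm0 ?ler01.
have [M M0 TM] := operator_nrm_bounded T.
exists M => _ [z /= z1 <-]; apply: le_trans (TM z) _.
by rewrite -[leRHS]mulr1 ler_wpM2l.
Qed.

Lemma opnormD S T : opnorm (S + T) <= opnorm S + opnorm T.
Proof.
apply: opnorm_le => [|x]; first by rewrite addr_ge0 ?opnorm_ge0.
apply: le_trans (nrmD _ _) _.
by rewrite mulrDl lerD ?opnormP.
Qed.

Lemma opnormN T : opnorm (- T) = opnorm T.
Proof.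
have h S : opnorm (- S) <= opnorm S.
  by apply: opnorm_le => [|x]; rewrite ?opnorm_ge0// nrmN opnormP.
by apply/eqP; rewrite eq_le h/= -{1}[T]opprK h.
Qed.

Lemma opnormB S T : opnorm (S - T) = opnorm (T - S).
Proof. by rewrite -opnormN opprB. Qed.

Lemma opnorm_triangle S T X : opnorm (S - T) <= opnorm (S - X) + opnorm (X - T).
Proof. by apply: le_trans (opnormD _ _); rewrite addrA subrK. Qed.

Lemma opnormM S T : opnorm (S * T) <= opnorm S * opnorm T.
Proof.
apply: opnorm_le => [|x]; first by rewrite mulr_ge0 ?opnorm_ge0.
apply: le_trans (opnormP S (T x)) _.
by rewrite -mulrA ler_wpM2l ?opnorm_ge0 ?opnormP.
Qed.

Lemma opnormZ_le c T : opnorm (c%:C *: T) <= `|c| * opnorm T.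
Proof.
apply: opnorm_le => [|x]; first by rewrite mulr_ge0 ?opnorm_ge0.
by rewrite nrmZ -mulrA ler_wpM2l ?opnormP.
Qed.

Lemma opnorm0 : opnorm (0 : operator H) = 0.
Proof.
apply/eqP; rewrite eq_le opnorm_ge0 andbT.
by apply: opnorm_le => // x; rewrite nrm0 mul0r.
Qed.

Lemma opnorm_eq0 T : opnorm T <= 0 -> T = 0.
Proof.
move=> T0; apply: operatorP => x; apply: nrm_eq0; apply/eqP.
rewrite eq_le nrm_ge0 andbT; apply: le_trans (opnormP _ _) _.
by rewrite mulr_le0_ge0 ?nrm_ge0.
Qed.

Lemma opnorm_eq S T : (forall e : R, 0 < e -> opnorm (S - T) <= e) -> S = T.
Proof.
move=> h; apply/eqP; rewrite -subr_eq0; apply/eqP/opnorm_eq0.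
by apply/ler_addgt0Pl => e /h; rewrite addr0.
Qed.

Lemma operator_complete (u : nat -> operator H) :
  (forall e : R, 0 < e -> exists N, forall m n, (N <= m)%N -> (N <= n)%N ->
     opnorm (u m - u n) <= e) ->
  exists X, forall e : R, 0 < e -> exists N, forall n, (N <= n)%N ->
     opnorm (u n - X) <= e.
Proof.
move=> cu.
have ex x : exists l, forall e : R, 0 < e -> exists N, forall n, (N <= n)%N ->
     nrm (u n x - l) <= e.
  apply: hilbert_complete => e e0.
  have d0 : 0 < e / (nrm x + 1) by rewrite divr_gt0// ltr_wpDl ?nrm_ge0.
  have [N uN] := cu _ d0; exists N => m n Nm Nn.
  apply: le_trans (opnormP (u m - u n) x) _.
  apply: le_trans (_ : e / (nrm x + 1) * nrm x <= _).
    by rewrite ler_wpM2r ?nrm_ge0 ?uN.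
  rewrite mulrAC ler_pdivrMr ?ltr_wpDl ?nrm_ge0//.
  by apply: ler_wpM2l; [exact: ltW|rewrite lerDl].
have [g gP] := choice ex.
(* Letting m tend to infinity in the Cauchy estimate makes the pointwise convergence uniform on the
   unit ball. Linearity, boundedness and norm convergence all follow from this. *)
have gU e : 0 < e -> exists N, forall n x, (N <= n)%N ->
    nrm (u n x - g x) <= e * nrm x.
  move=> e0; have [N uN] := cu _ e0; exists N => n x Nn.
  apply/ler_addgt0Pr => d d0.
  have [K gK] := gP x _ d0.
  pose m := maxn N K.
  have -> : u n x - g x = (u n - u m) x + (u m x - g x).
    by rewrite /= addrA subrK.
  apply: le_trans (nrmD _ _) _; apply: lerD.
    apply: le_trans (opnormP _ _) _.
    by rewrite ler_wpM2r ?nrm_ge0// uN// leq_maxl.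
  by rewrite gK// leq_maxr.
have gl : linear g.
  move=> a x y; apply/eqP; rewrite -subr_eq0; apply/eqP/nrm_eq0/eqP.
  rewrite eq_le nrm_ge0 andbT; apply/ler_addgt0Pr => e e0; rewrite add0r.
  pose K := nrm (a *: x + y) + complex.Re `|a| * nrm x + nrm y + 1.
  have a0 : 0 <= complex.Re `|a|.
    by have := normr_ge0 a; rewrite lecE => /andP[].
  have K0 : 0 < K by rewrite ltr_wpDl// !addr_ge0 ?mulr_ge0 ?nrm_ge0.
  have [N gN] := gU _ (divr_gt0 e0 K0).
  have h z : nrm (u N z - g z) <= e / K * nrm z by apply: gN.
  have -> : g (a *: x + y) - (a *: g x + g y) =
      - (u N (a *: x + y) - g (a *: x + y)) +
      (a *: (u N x - g x) + (u N y - g y)).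
    rewrite [u N (_ + _)]linearP/= scalerBr.
    move: (a *: u N x) (u N y) => p r.
    by rewrite [p - _ + _]addrACA -[- _ - g y]opprD opprB addrA subrK.
  apply: le_trans (nrmD _ _) _; rewrite nrmN.
  apply: le_trans (lerD (h (a *: x + y)) (nrmD _ _)) _; rewrite nrmZC.
  have h1 := ler_wpM2l a0 (h x); have h2 := h y.
  have dK : e / K * K = e by rewrite divfK// gt_eqF.
  have d0 : 0 <= e / K by rewrite divr_ge0// ltW.
  move: (e / K) d0 h1 h2 dK; rewrite /K => d d0 h1 h2 <-.
  by nra.
have gb : exists M, forall x, `|g x| <= M * `|x|.
  have [N gN] := gU _ ltr01.
  exists (opnorm (u N) + 1)%:C => x.
  rewrite !normr_nrm -rmorphM/= lecR.
  have -> : g x = u N x - (u N x - g x) by rewrite opprB addrC subrK.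
  apply: le_trans (nrmD _ _) _; rewrite nrmN mulrDl lerD ?opnormP//.
  exact: gN.
exists (Operator gl gb) => e e0; have [N gN] := gU _ e0.
by exists N => n Nn; apply: opnorm_le => [|x]; [exact: ltW|exact: gN].
Qed.

End Hilbert.

(** * Order and invertibility *)

Section Order.
Context {R : realType} {H : hilbertType R}.
Implicit Types (x y z : H) (c m M : R)
  (S T X Y C : operator H).

Lemma selfadjoint_ip T x y : selfadjoint T -> ip (T x) y = ip x (T y).
Proof. by move=> /selfadjointP. Qed.

Lemma ip0l x : ip 0 x = 0.
Proof. by rewrite -(subrr x) ipBl subrr. Qed.

Lemma ip0r x : ip x 0 = 0.
Proof. by rewrite ipC ip0l. Qed.

Lemma selfadjoint0 : selfadjoint (0 : operator H).
Proof. by apply/selfadjointP => x y; rewrite ip0l ip0r. Qed.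

Lemma selfadjoint1 : selfadjoint (1 : operator H).
Proof. by []. Qed.

Lemma selfadjointD S T : selfadjoint S -> selfadjoint T -> selfadjoint (S + T).
Proof.
move=> /selfadjointP sS /selfadjointP sT; apply/selfadjointP => x y /=.
by rewrite !ipE sS sT.
Qed.

Lemma selfadjointN T : selfadjoint T -> selfadjoint (- T).
Proof.
by move=> /selfadjointP sT; apply/selfadjointP => x y /=; rewrite !ipE sT.
Qed.

Lemma selfadjointB S T : selfadjoint S -> selfadjoint T -> selfadjoint (S - T).
Proof. by move=> sS sT; apply/selfadjointD/selfadjointN. Qed.

Lemma selfadjointZ c T : selfadjoint T -> selfadjoint (c%:C *: T).
Proof.
by move=> /selfadjointP sT; apply/selfadjointP => x y /=; rewrite !ipE sT.
Qed.

Lemma selfadjoint_conj C T :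
  selfadjoint C -> selfadjoint T -> selfadjoint (C * T * C).
Proof.
by move=> sC sT x y /=; rewrite sC sT sC.
Qed.

Lemma selfadjointX T k : selfadjoint T -> selfadjoint (T ^+ k).
Proof.
move=> sT; elim: k => [//|k IH] x y.
by rewrite {1}exprS exprSr/= sT IH.
Qed.

Lemma positive_selfadjoint T : positive T -> selfadjoint T.
Proof. by move=> /positiveP[]. Qed.

Lemma positive_ip T x : positive T -> 0 <= ip (T x) x.
Proof. by move=> /positiveP[]. Qed.

Lemma positive1 : positive (1 : operator H).
Proof. by apply/positiveP; split=> // x; exact: ip_ge0. Qed.

Lemma positive0 : positive (0 : operator H).
Proof.
apply/positiveP; split=> [|x]; first exact: selfadjoint0.
by rewrite ip0l.
Qed.

Lemma positiveD S T : positive S -> positive T -> positive (S + T).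
Proof.
move=> /positiveP[sS pS] /positiveP[sT pT]; apply/positiveP.
by split=> [|x]; [exact: selfadjointD|rewrite ipE addr_ge0].
Qed.

Lemma positiveZ c T : 0 <= c -> positive T -> positive (c%:C *: T).
Proof.
move=> c0 /positiveP[sT pT]; apply/positiveP.
by split=> [|x]; [exact: selfadjointZ|rewrite ipE mulr_ge0].
Qed.

Lemma positive_conj C T : selfadjoint C -> positive T -> positive (C * T * C).
Proof.
move=> sC /positiveP[sT pT]; apply/positiveP.
split=> [|x]; first exact: selfadjoint_conj.
by rewrite [ip _ _](selfadjoint_ip _ _ sC).
Qed.

Lemma positive_sqr C : selfadjoint C -> positive (C * C).
Proof. by move=> sC; have := positive_conj sC positive1; rewrite mulr1. Qed.

Lemma positive_trans X Y T :
  positive (X - Y) -> positive (Y - T) -> positive (X - T).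
Proof. by move=> XY YT; have := positiveD XY YT; rewrite addrA subrK. Qed.

Lemma positive_ZB c d : c <= d ->
  positive (d%:O - c%:O : operator H).
Proof.
move=> cd; rewrite -scalerBl -rmorphB/=.
by apply: positiveZ positive1; rewrite subr_ge0.
Qed.

Lemma CauchySchwarz_nrm x y : `|ip x y| <= nrm x * nrm y.
Proof.
rewrite -ler_sqr ?nnegrE ?mulr_ge0 ?nrm_ge0//.
rewrite exprMn -!ip_nrm real_normK ?num_real//.
exact: (CS_form x y positive1).
Qed.

Lemma ip_opnorm T x : `|ip (T x) x| <= opnorm T * ip x x.
Proof.
apply: le_trans (CauchySchwarz_nrm _ _) _.
by rewrite ip_nrm expr2 mulrA ler_wpM2r ?nrm_ge0 ?opnormP.
Qed.

(** Polarization and the parallelogram law give 4 ip (T x) y <= 2 M (|x|^2 + |y|^2); then y is T x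
    rescaled to the norm of x. *)
Lemma opnorm_selfadjoint T M : selfadjoint T -> 0 <= M ->
  (forall x, `|ip (T x) x| <= M * ip x x) -> opnorm T <= M.
Proof.
move=> sT M0 TM; apply: opnorm_le => // x.
have pol y : 4 * ip (T x) y <= M * (2 * ip x x + 2 * ip y y).
  have := TM (x - y); have := TM (x + y).
  rewrite linearD linearB/= !ipE [ip (T y) x]ipC -(selfadjoint_ip _ _ sT).
  rewrite [ip y x]ipC !ler_norml => /andP[_ h1] /andP[h2 _].
  by nra.
have [t0|t0] := eqVneq (nrm (T x)) 0; first by rewrite t0 mulr_ge0 ?nrm_ge0.
have tp : 0 < nrm (T x) by rewrite lt_neqAle eq_sym t0 nrm_ge0.
have ap : 0 < nrm x.
  rewrite lt_neqAle nrm_ge0 eq_sym andbT; apply: contra_neq t0 => /nrm_eq0 ->.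
  by rewrite linear0 nrm0.
have := pol ((nrm x / nrm (T x))%:C *: T x).
rewrite !ipE !ip_nrm; move: (nrm x) (nrm (T x)) tp ap => a b b0 a0.
have -> : 4 * (a / b * b ^+ 2) = 4 * a * b by field; rewrite gt_eqF.
have -> : a / b * (a / b * b ^+ 2) = a ^+ 2 by field; rewrite gt_eqF.
move=> h; have {}h : a * (b - M * a) <= 0 by nra.
by move: h; rewrite pmulr_rle0// subr_le0.
Qed.

Lemma opnorm_le_positive T M : selfadjoint T -> 0 <= M ->
  positive (M%:O - T) -> positive (T + M%:O) -> opnorm T <= M.
Proof.
move=> sT M0 p1 p2; apply: opnorm_selfadjoint => // x.
have := positive_ip x p1; have := positive_ip x p2; rewrite /= !ipE => h1 h2.
by rewrite ler_norml; apply/andP; split; lra.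
Qed.

Lemma positive_opnorm T M : selfadjoint T -> opnorm T <= M ->
  positive (M%:O - T).
Proof.
move=> sT TM; apply/positiveP; split=> [|x].
  by apply: selfadjointB => //; apply: selfadjointZ; apply: selfadjoint1.
rewrite /= !ipE subr_ge0.
apply: le_trans (ler_norm _) _; apply: le_trans (ip_opnorm _ _) _.
by rewrite ler_wpM2r ?ip_ge0.
Qed.

(** Cauchy-Schwarz for the form of T, applied to x and T x. *)
Lemma positive_norm_sqr T x : positive T ->
  ip (T x) (T x) <= opnorm T * ip (T x) x.
Proof.
move=> pT; have h := CS_form x (T x) pT.
have h2 : ip (T (T x)) (T x) <= opnorm T * ip (T x) (T x).
  by apply: le_trans (ler_norm _) (ip_opnorm _ _).
have := positive_ip x pT; have := ip_ge0 (T x); have := opnorm_ge0 T.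
move: (ip (T x) (T x)) (ip (T x) x) (ip (T (T x)) (T x)) (opnorm T) h h2.
move=> a b d N h h2 N0 a0 b0.
have [->|an] := eqVneq a 0; first by rewrite mulr_ge0.
have ap : 0 < a by rewrite lt_neqAle eq_sym an.
by rewrite -(ler_pM2l ap); nra.
Qed.

Lemma invertible_surj T c : 0 < c -> (forall x, c * nrm x <= nrm (T x)) ->
  (forall y, exists x, T x = y) -> invertible T.
Proof.
move=> c0 Tc /choice[g gT].
have inj x y : T x = T y -> x = y.
  move=> Txy; apply/eqP; rewrite -subr_eq0; apply/eqP/nrm_eq0/eqP.
  rewrite eq_le nrm_ge0 andbT -(pmulr_rle0 _ c0).
  by apply: le_trans (Tc _) _; rewrite linearB/= Txy subrr nrm0.
have gl : linear g.
  by move=> a x y; apply: inj; rewrite gT linearP/= !gT.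
have gb : exists M : R[i], forall x, `|g x| <= M * `|x|.
  exists (c^-1)%:C => x.
  rewrite !normr_nrm -rmorphM/= lecR mulrC ler_pdivlMr// mulrC -{2}(gT x).
  exact: Tc.
exists (Operator gl gb); split; apply: operatorP => x /=; last exact: gT.
by apply: inj; rewrite gT.
Qed.

(** After scaling by K = |T| + c, the operator E = 1 - T / K is a contraction of ratio q. The
    equation T x = y becomes l = y + E l with x = l / K, solved by iteration from 0 (a Neumann
    series). The summand c keeps K positive on the zero space. *)
Lemma invertible_lower_bound T c : selfadjoint T -> 0 < c ->
  (forall x, c * ip x x <= ip (T x) x) -> invertible T.
Proof.
move=> sT c0 Tc.
apply: (@invertible_surj T c) => // [x|y].
  have := Tc x; rewrite ip_nrm => h.
  have := le_trans (ler_norm _) (CauchySchwarz_nrm (T x) x).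
  move: (nrm x) (nrm (T x)) (nrm_ge0 x) (nrm_ge0 (T x)) h => a b a0 b0 h h2.
  have [->|an] := eqVneq a 0; first by rewrite mulr0.
  have ap : 0 < a by rewrite lt_neqAle eq_sym an.
  by rewrite -(ler_pM2r ap); nra.
pose K := opnorm T + c.
have K0 : 0 < K by rewrite ltr_wpDl ?opnorm_ge0.
pose E : operator H := 1 - K^-1%:C *: T.
pose q := 1 - c / K.
have q0 : 0 <= q by rewrite subr_ge0 ler_pdivrMr// mul1r lerDr opnorm_ge0.
have q1 : q < 1 by rewrite ltrBlDr ltrDl divr_gt0.
have Eq : opnorm E <= q.
  apply: opnorm_selfadjoint => //.
    by apply: selfadjointB; [exact: selfadjoint1|exact: selfadjointZ].
  move=> x; rewrite /E /= !ipE /q.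
  have h1 := Tc x; have h2 := le_trans (ler_norm _) (ip_opnorm T x).
  have x0 := ip_ge0 x.
  have h3 : K^-1 * ip (T x) x <= ip x x.
    by rewrite ler_pdivrMl// /K mulrDl; nra.
  have h4 : c / K * ip x x <= K^-1 * ip (T x) x.
    by rewrite mulrAC mulrC ler_wpM2l ?invr_ge0// ltW.
  by rewrite ger0_norm; lra.
have Eqx x : nrm (E x) <= q * nrm x.
  apply: le_trans (opnormP _ _) _; by rewrite ler_wpM2r ?nrm_ge0.
pose u := fix u k := if k is k'.+1 then y + E (u k') else (0 : H).
have uS k : u k.+1 = y + E (u k) by [].
have ub k : nrm (u k) <= nrm y / (1 - q).
  have q1' : 0 < 1 - q by lra.
  elim: k => [|k IH]; first by rewrite nrm0 divr_ge0 ?nrm_ge0 ?ltW.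
  rewrite uS; apply: le_trans (nrmD _ _) _.
  apply: le_trans (lerD (lexx _) (Eqx _)) _.
  apply: le_trans (lerD (lexx _) (ler_wpM2l q0 IH)) _.
  rewrite le_eqVlt; apply/orP; left; apply/eqP; field; lra.
have ud k n : nrm (u (n + k)%N - u n) <= q ^+ n * (nrm y / (1 - q)).
  elim: n => [|n IH]; first by rewrite add0n expr0 mul1r subr0.
  rewrite addSn !uS opprD addrACA subrr add0r -linearB.
  by apply: le_trans (Eqx _) _; rewrite exprS -mulrA ler_wpM2l.
have q1' : 0 < 1 - q by lra.
have B0 : 0 <= nrm y / (1 - q) by rewrite divr_ge0 ?nrm_ge0 ?ltW.
have [|l ul] := hilbert_complete (u := u).
  move=> e e0.
  have q_lt1 : `|q| < 1 by rewrite ger0_norm.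
  have d0 : 0 < e / 2 / (nrm y / (1 - q) + 1).
    by rewrite !divr_gt0// ltr_wpDl.
  have /cvgrPdist_le/(_ _ d0)[N _ /(_ N (leqnn N))/=] := cvg_expr q_lt1.
  rewrite sub0r normrN ger0_norm ?exprn_ge0// => qN.
  have qe : q ^+ N * (nrm y / (1 - q)) <= e / 2.
    move: qN; rewrite ler_pdivlMr ?ltr_wpDl// => qN.
    apply: le_trans qN; rewrite ler_wpM2l ?exprn_ge0// lerDl.
    by [].
  exists N => m n /subnKC <- /subnKC <-.
  set a := u (N + _)%N; set b := u (N + _)%N.
  have -> : a - b = (a - u N) - (b - u N) by rewrite opprB addrA subrK.
  apply: le_trans (nrmD _ _) _; rewrite nrmN.
  have := le_trans (ud (m - N)%N N) qe; have := le_trans (ud (n - N)%N N) qe.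
  by rewrite -/a -/b; lra.
exists (K^-1%:C *: l).
suff : l = y + E l.
  rewrite linearZ /E /= addrCA => /eqP.
  by rewrite -subr_eq0 opprD addrA subrr add0r oppr_eq0 subr_eq0 eq_sym => /eqP.
apply/eqP; rewrite -subr_eq0; apply/eqP/nrm_eq0/eqP.
rewrite eq_le nrm_ge0 andbT; apply/ler_addgt0Pr => e e0; rewrite add0r.
have e20 : 0 < e / 2 by lra.
have [N uN] := ul _ e20.
have -> : l - (y + E l) = (u N.+1 - (y + E l)) - (u N.+1 - l).
  by move: (y + E l) => w; rewrite opprB [RHS]addrC addrA subrK.
rewrite {1}uS opprD addrACA subrr add0r -linearB.
apply: le_trans (nrmD _ _) _; rewrite nrmN.
have := uN _ (leqnSn N); have := uN _ (leqnn N); have := Eqx (u N - l).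
have := nrm_ge0 (u N - l); nra.
Qed.

(** With S the inverse of T, |x| <= |S| |T x|, while |T x|^2 <= |T| ip (T x) x by
    [positive_norm_sqr]. *)
Lemma positive_lower_bound T : positive T -> invertible T ->
  exists2 c, 0 < c & forall x, c * ip x x <= ip (T x) x.
Proof.
move=> pT [S [ST _]].
pose K := opnorm S + 1; pose N := opnorm T + 1.
have K0 : 0 < K by rewrite ltr_wpDl ?opnorm_ge0.
have N0 : 0 < N by rewrite ltr_wpDl ?opnorm_ge0.
exists ((K ^+ 2 * N)^-1) => [|x]; first by rewrite invr_gt0 mulr_gt0 ?exprn_gt0.
rewrite ler_pdivrMl ?mulr_gt0 ?exprn_gt0//.
have STx : S (T x) = x by have := congr1 (fun X : operator H => X x) ST.
have h1 : nrm x <= K * nrm (T x).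
  rewrite -{1}STx; apply: le_trans (opnormP _ _) _.
  by rewrite ler_wpM2r ?nrm_ge0 ?lerDl.
have h2 : ip x x <= K ^+ 2 * ip (T x) (T x).
  by rewrite !ip_nrm -exprMn ler_sqr ?nnegrE ?mulr_ge0 ?nrm_ge0 ?(ltW K0).
apply: le_trans h2 _; rewrite -[leRHS]mulrA ler_wpM2l ?exprn_ge0 ?(ltW K0)//.
apply: le_trans (positive_norm_sqr x pT) _.
by rewrite ler_wpM2r ?positive_ip ?lerDl.
Qed.

(** At the infimum m the operator S - m is positive; were it invertible, [positive_lower_bound]
    would allow a larger m. The nonzero vector [x0] bounds the candidates from above. *)
Lemma numerical_infimum S (x0 : H) : selfadjoint S -> x0 != 0 ->
  exists m, [/\ (forall x, m * ip x x <= ip (S x) x),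
    (forall c, (forall x, c * ip x x <= ip (S x) x) -> c <= m) &
    ~ invertible (S - m%:O)].
Proof.
move=> sS x0n.
have x0p : 0 < ip x0 x0.
  rewrite ip_nrm exprn_gt0// lt_neqAle nrm_ge0 eq_sym andbT.
  by apply: contra_neq x0n; exact: nrm_eq0.
pose E := [set c | forall x, c * ip x x <= ip (S x) x].
have Eub : has_ubound E.
  exists (ip (S x0) x0 / ip x0 x0) => c Ec; rewrite ler_pdivlMr//; exact: Ec.
have E0 : E !=set0.
  exists (- opnorm S) => x /=; have := ip_opnorm S x.
  by rewrite ler_norml mulNr => /andP[].
have supE : E (sup E).
  move=> x /=; have [x00|x00] := eqVneq (ip x x) 0.
    have -> : x = 0 by apply: nrm_eq0; apply/eqP; rewrite -sqrf_eq0 -ip_nrm x00.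
    by rewrite linear0 ip0l mulr0.
  have xp : 0 < ip x x by rewrite lt_neqAle eq_sym x00 ip_ge0.
  rewrite -ler_pdivlMr//; apply: ge_sup => // c Ec.
  by rewrite ler_pdivlMr//; exact: Ec.
exists (sup E); split=> // [c Ec|iS]; first exact: ub_le_sup.
have pS : positive (S - (sup E)%:O).
  apply/positiveP; split=> [|x]; last by rewrite /= !ipE subr_ge0; exact: supE.
  by apply/selfadjointB/selfadjointZ => //; exact: selfadjoint1.
have [c c0 Sc] := positive_lower_bound pS iS.
have : E (sup E + c).
  by move=> x; have := Sc x; rewrite /= !ipE; lra.
by move/(ub_le_sup Eub); rewrite gerDl leNgt c0.
Qed.

End Order.

(** * Spectrum and polynomial calculus *)

Section Horner.
Context {R : realType} {H : hilbertType R}.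
Implicit Types (x y z : H) (a b c m M : R)
  (S T X Y C : operator H).
Implicit Types (p q : {poly R}).

Lemma opscaleAl (k : R[i]) S T : (k *: S) * T = k *: (S * T).
Proof. by apply: operatorP. Qed.

Lemma opscaleAr (k : R[i]) S T : S * (k *: T) = k *: (S * T).
Proof. by apply: operatorP => x /=; rewrite linearZ. Qed.

Lemma op_horner_wide n p T : (size p <= n)%N ->
  op_horner p T = \sum_(i < n) (p`_i)%:C *: T ^+ i.
Proof.
move=> pn; rewrite /op_horner.
rewrite (big_ord_widen n (fun i => (p`_i)%:C *: T ^+ i) pn).
rewrite big_mkcond; apply: eq_bigr => i _; case: ltnP => // ip.
by rewrite nth_default// rmorph0 scale0r.
Qed.

Lemma op_hornerD p q T : op_horner (p + q) T = op_horner p T + op_horner q T.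
Proof.
pose n := maxn (size p) (size q).
rewrite !(@op_horner_wide n) ?leq_maxl ?leq_maxr ?size_polyD//.
rewrite -big_split; apply: eq_bigr => i _ /=.
by rewrite coefD rmorphD scalerDl.
Qed.

Lemma op_hornerZ c p T : op_horner (c *: p) T = c%:C *: op_horner p T.
Proof.
rewrite !(@op_horner_wide (size p)) ?size_scale_leq//.
rewrite scaler_sumr; apply: eq_bigr => i _ /=.
by rewrite coefZ rmorphM/= scalerA.
Qed.

Lemma op_hornerC c T : op_horner c%:P T = c%:O.
Proof.
by rewrite (@op_horner_wide 1%N) ?size_polyC_leq1// big_ord1 coefC expr0.
Qed.

Lemma op_hornerMX p T : op_horner (p * 'X) T = op_horner p T * T.
Proof.
rewrite (@op_horner_wide (size p).+1); last first.
  by have [->|p0] := eqVneq p 0; rewrite ?mul0r ?size_poly0 ?size_mulX.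
rewrite big_ord_recl coefMX/= rmorph0 scale0r add0r (@op_horner_wide (size p))//.
rewrite mulr_suml; apply: eq_bigr => i _ /=.
by rewrite coefMX/= exprSr opscaleAl.
Qed.

Lemma op_hornerX T : op_horner 'X T = T.
Proof. by rewrite -['X]mul1r op_hornerMX op_hornerC rmorph1 scale1r mul1r. Qed.

Lemma op_hornerN p T : op_horner (- p) T = - op_horner p T.
Proof. by rewrite -scaleN1r op_hornerZ rmorphN1 scaleN1r. Qed.

Lemma op_hornerB p q T : op_horner (p - q) T = op_horner p T - op_horner q T.
Proof. by rewrite op_hornerD op_hornerN. Qed.

Lemma op_hornerM p q T : op_horner (p * q) T = op_horner p T * op_horner q T.
Proof.
elim/poly_ind: q => [|q c IH].
  by rewrite mulr0 op_hornerC rmorph0 scale0r mulr0.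
rewrite mulrDr mulrA !op_hornerD !op_hornerMX IH mulrDr mulrA; congr (_ + _).
by rewrite mulrC mul_polyC op_hornerZ op_hornerC opscaleAr mulr1.
Qed.

Lemma op_horner_swap p S T D : S * D = D * T ->
  op_horner p S * D = D * op_horner p T.
Proof.
move=> SD; elim/poly_ind: p => [|p c IH].
  by rewrite !op_hornerC rmorph0 !scale0r mul0r mulr0.
rewrite !op_hornerD !op_hornerMX !op_hornerC mulrDl mulrDr -mulrA SD !mulrA IH.
by rewrite opscaleAl opscaleAr mul1r mulr1.
Qed.

Lemma selfadjoint_horner p T : selfadjoint T -> selfadjoint (op_horner p T).
Proof.
move=> sT; rewrite /op_horner; elim/big_ind: _ => [||i _].
- exact: selfadjoint0.
- by move=> X Y; exact: selfadjointD.
- by apply: selfadjointZ; exact: selfadjointX.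
Qed.

Lemma invertibleM S T : invertible S -> invertible T -> invertible (S * T).
Proof.
move=> [S' [S1 S2]] [T' [T1 T2]]; exists (T' * S'); split.
  by rewrite mulrA -[T' * _ * _]mulrA S1 mulr1.
by rewrite mulrA -[S * _ * _]mulrA T2 mulr1.
Qed.

Lemma invertible_const c : c != 0 -> invertible (c%:O : operator H).
Proof.
move=> c0; exists (c^-1)%:O.
by split; rewrite opscaleAl mul1r scalerA -rmorphM/= ?mulVf ?divff// scale1r.
Qed.

Lemma invertible_opp T : invertible (- T) -> invertible T.
Proof.
move=> [S [ST TS]]; exists (- S).
by split; [rewrite mulNr -mulrN|rewrite mulrN -mulNr].
Qed.

Lemma spectrumP T c : spectrum T c%:C <-> ~ invertible (T - c%:O).
Proof.
rewrite /spectrum /=; split; apply: contra_not => iT; apply: invertible_opp;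
  by rewrite opprB.
Qed.

(** Induction on the degree, splitting off a root found over the complex numbers. A real root lies
    outside the spectrum by hypothesis. A nonreal root a + bi contributes the factor (T - a)^2 +
    b^2, which is bounded below by b^2. *)
Lemma horner_invertible p T : selfadjoint T -> p != 0 ->
  (forall c, spectrum T c%:C -> p.[c] != 0) -> invertible (op_horner p T).
Proof.
move=> sT; have [n] := ubnP (size p); elim: n p => // n IH p pn p0 pT.
have [p1|p1] := leqP (size p) 1.
  move: p0; rewrite (size1_polyC p1) op_hornerC polyC_eq0.
  exact: invertible_const.
have /closed_rootP[[a b] pz] : size (map_poly (real_complex R) p) != 1%N.
  by rewrite size_map_inj_poly ?gtn_eqF//; exact: complexI.
have [b0|b0] := eqVneq b 0.
  have pa : root p a.
    by move: pz; rewrite b0 (_ : Complex a 0 = real_complex R a)// fmorph_root.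
  have /factor_theorem[q pE] := pa.
  have q0 : q != 0 by apply: contra_neq p0 => q0; rewrite pE q0 mul0r.
  rewrite pE op_hornerM op_hornerB op_hornerX op_hornerC; apply: invertibleM.
    apply: IH => //.
      move: pn; by rewrite pE size_mul ?polyXsubC_eq0// size_XsubC addn2.
    move=> c /pT; rewrite pE hornerM; apply: contra_neq => ->; exact: mul0r.
  have [//|nT] := pselect (invertible (T - a%:O)).
  by have /pT := proj2 (spectrumP T a) nT; rewrite (rootP pa) eqxx.
pose d := ('X - a%:P) ^+ 2 + (b ^+ 2)%:P : {poly R}.
have sd : size d = 3%N.
  rewrite size_polyDl ?size_exp_XsubC//.
  by rewrite (leq_ltn_trans (size_polyC_leq1 _)).
have d0 : d != 0 by rewrite -size_poly_eq0 sd.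
have dz : (map_poly (real_complex R) d).[Complex a b] = 0.
  rewrite /d rmorphD/= rmorphXn/= rmorphB/= map_polyX !map_polyC/=.
  rewrite hornerD horner_exp hornerXsubC hornerC.
  by apply/eqP; rewrite eq_complex/=; apply/andP; split; apply/eqP; ring.
(* The remainder has real coefficients and degree at most 1, and it vanishes at a nonreal point. *)
have r0 : modp p d = 0.
  have sr : (size (modp p d) <= 2)%N by rewrite -ltnS -sd ltn_modp.
  have := rootP pz; rewrite {1}(divp_eq p d) rmorphD rmorphM/= hornerD hornerM.
  rewrite dz mulr0 add0r (@horner_coef_wide _ 2); last first.
    by rewrite size_map_inj_poly//; exact: complexI.
  rewrite !big_ord_recl big_ord0 !coef_map/= expr0 expr1 mulr1 addr0.
  case; rewrite !(mul0r, subr0, add0r, addr0) => h1 /eqP.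
  rewrite mulf_eq0 (negPf b0) orbF => /eqP h2.
  apply/polyP => -[|[|k]]; rewrite coef0.
  - by move: h1; rewrite h2 mul0r addr0.
  - exact: h2.
  - by rewrite nth_default// (leq_trans sr).
have pE : p = (divp p d) * d by rewrite {1}(divp_eq p d) r0 addr0.
have q0 : divp p d != 0 by apply: contra_neq p0 => q0; rewrite pE q0 mul0r.
rewrite pE op_hornerM; apply: invertibleM.
  apply: IH => //.
    move: pn; rewrite {1}pE size_mul// sd addn3 /= ltnS => h.
    by apply: leq_trans h.
  by move=> c /pT; rewrite {1}pE hornerM; apply: contra_neq => ->; exact: mul0r.
have sTa : selfadjoint (T - a%:O).
  by apply: selfadjointB => //; apply: selfadjointZ; exact: selfadjoint1.
apply: (@invertible_lower_bound _ _ _ (b ^+ 2)) => [||x].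
- exact: selfadjoint_horner.
- by rewrite exprn_even_gt0.
- rewrite /d op_hornerD expr2 op_hornerM !op_hornerB !op_hornerX !op_hornerC.
  have -> X c : ip ((X + c%:O) x) x = ip (X x) x + c * ip x x.
    by rewrite /= ipDl ipZl.
  by rewrite lerDr; exact: (positive_ip x (positive_sqr sTa)).
Qed.

Lemma positive_horner p T : selfadjoint T ->
  (forall c, spectrum T c%:C -> 0 <= p.[c]) -> positive (op_horner p T).
Proof.
move=> sT pT; apply/positiveP; split=> [|x0]; first exact: selfadjoint_horner.
have [->|x0n] := eqVneq x0 0; first by rewrite ip0r.
have x0p : 0 < ip x0 x0.
  rewrite ip_nrm exprn_gt0// lt_neqAle nrm_ge0 eq_sym andbT.
  by apply: contra_neq x0n; exact: nrm_eq0.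
have [m [mp _ mi]] := numerical_infimum (selfadjoint_horner p sT) x0n.
rewrite leNgt; apply/negP => px0.
have m0 : m < 0.
  by rewrite -(pmulr_llt0 _ x0p); exact: le_lt_trans (mp x0) px0.
(* If p is the constant m there is nothing to factor; the contradiction then needs a point of the
   spectrum, supplied by the numerical range of T itself. *)
have [pm|pm] := eqVneq (p - m%:P) 0.
  have [t [_ _ /(proj2 (spectrumP T t))/pT]] := numerical_infimum sT x0n.
  by move/eqP: pm; rewrite subr_eq0 => /eqP ->; rewrite hornerC leNgt m0.
apply: mi; rewrite -(op_hornerC _ T) -op_hornerB.
apply: horner_invertible => // c.
by move=> /pT; rewrite hornerD hornerN hornerC => h; rewrite gt_eqF//; lra.
Qed.

Lemma opnorm_horner p T e : selfadjoint T -> 0 <= e ->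
  (forall c, spectrum T c%:C -> `|p.[c]| <= e) -> opnorm (op_horner p T) <= e.
Proof.
move=> sT e0 pT; apply: opnorm_le_positive => //; first exact: selfadjoint_horner.
- rewrite -(op_hornerC _ T) -op_hornerB; apply: positive_horner => // c /pT.
  by rewrite hornerD hornerN hornerC ler_norml => /andP[h1 h2]; lra.
- rewrite -(op_hornerC _ T) -op_hornerD; apply: positive_horner => // c /pT.
  by rewrite hornerD hornerC ler_norml => /andP[h1 h2]; lra.
Qed.

(** Positivity of both differences already yields that T is self-adjoint ([bounds_selfadjoint]) and
    that its real spectral values lie in [m, M] ([bounds_spectrum]). *)
Definition bounds m M T := positive (T - m%:O) /\ positive (M%:O - T).

Lemma bounds_selfadjoint m M T : bounds m M T -> selfadjoint T.
Proof.
move=> [/positive_selfadjoint sT _].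
have := selfadjointD sT (selfadjointZ m selfadjoint1).
by rewrite subrK.
Qed.

Lemma bounds_spectrum m M T c : bounds m M T -> spectrum T c%:C -> m <= c <= M.
Proof.
move=> bT /spectrumP; have sT := bounds_selfadjoint bT.
have sTc : selfadjoint (T - c%:O).
  by apply: selfadjointB => //; apply: selfadjointZ; exact: selfadjoint1.
case: bT => pm pM.
apply: contra_notP => /negP; rewrite negb_and -!ltNge => /orP[cm|cm].
  apply: (@invertible_lower_bound _ _ _ (m - c)) => // [|x]; first lra.
  by have := positive_ip x pm; rewrite /= !ipE; lra.
apply: invertible_opp; rewrite opprB.
apply: (@invertible_lower_bound _ _ _ (c - M)) => [||x]; last 2 first.
- by lra.
- by have := positive_ip x pM; rewrite /= !ipE; lra.
- by rewrite -opprB; exact: selfadjointN.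
Qed.

Lemma op_horner_bounds m M T p e : bounds m M T -> 0 <= e ->
  (forall c, m <= c <= M -> `|p.[c]| <= e) -> opnorm (op_horner p T) <= e.
Proof.
move=> bT e0 pe; apply: opnorm_horner => //; first exact: bounds_selfadjoint bT.
by move=> c /(bounds_spectrum bT)/pe.
Qed.

End Horner.

(** * Continuous functional calculus *)

Section Cfc.
Context {R : realType} {H : hilbertType R}.
Implicit Types (x y z : H) (a b c e m M : R)
  (S T X Y C : operator H).
Implicit Types (p q : {poly R}) (f g : R -> R).

Lemma cvg_uniform_horner (A : set R) (p : nat -> {poly R}) f :
  {uniform A, (fun k => horner (p k)) @ \oo --> f} <->
  forall e, 0 < e -> exists N, forall k, (N <= k)%N ->
    forall c, A c -> `|(p k).[c] - f c| <= e.
Proof.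
split=> [pf e e0|pf P /uniform_nbhs[E [entE EP]]].
  have : nbhs (f : {uniform` A -> R})
      [set h : R -> R | forall c, A c -> `|h c - f c| <= e].
    apply/uniform_nbhs; exists [set xy | `|xy.1 - xy.2| < e]; split.
      exact: entourage_ball (PosNum e0).
    by move=> h hE y Ay; rewrite distrC ltW//; exact: hE.
  by move/pf => [N _ NP]; exists N => k Nk; exact: NP.
move: entE; rewrite -entourage_ballE => -[e /= e0 eE].
have e20 : 0 < e / 2 by lra.
have [N NP] := pf _ e20; exists N => // k /= Nk; apply: EP => y Ay.
apply: eE => /=; rewrite -ball_normE/= distrC.
by apply: le_lt_trans (NP k Nk y Ay) _; lra.
Qed.

Lemma cvg_to0P (u : nat -> R) : (forall k, 0 <= u k) ->
  (u k @[k --> \oo] --> (0 : R)) <->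
  forall e, 0 < e -> exists N, forall k, (N <= k)%N -> u k <= e.
Proof.
move=> u0; split=> [/cvgrPdist_le cu e /cu[N _ NP]|cu].
  by exists N => k /NP; rewrite /= sub0r normrN ger0_norm.
apply/cvgrPdist_le => e /cu[N NP]; exists N => // k /NP.
by rewrite /= sub0r normrN ger0_norm.
Qed.

Lemma is_cfc_exists m M T f : bounds m M T -> polynomially_approximable m M f ->
  exists X, is_cfc f T X.
Proof.
move=> bT af.
have /choice[p pf] (k : nat) : exists p : {poly R},
    forall c, m <= c <= M -> `|p.[c] - f c| <= k.+1%:R^-1.
  by apply: af; rewrite invr_gt0 ltr0n.
have small e : 0 < e -> exists N, forall k, (N <= k)%N -> k.+1%:R^-1 <= e.
  move=> e0; exists (Num.bound e^-1) => k Nk.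
  rewrite -[e]invrK lef_pV2 ?posrE ?invr_gt0 ?ltr0n//.
  apply: ltW; apply: lt_le_trans (archi_boundP _) _; first by rewrite invr_ge0 ltW.
  by rewrite ler_nat leqW.
have [|X pX] := @operator_complete _ _ (fun k => op_horner (p k) T).
  move=> e e0; have e20 : 0 < e / 2 by lra.
  have [N NP] := small _ e20; exists N => k l Nk Nl.
  rewrite -op_hornerB; apply: (op_horner_bounds bT (ltW e0)) => c cmM.
  rewrite hornerD hornerN.
  have -> : (p k).[c] - (p l).[c] = ((p k).[c] - f c) - ((p l).[c] - f c) by ring.
  apply: le_trans (ler_normB _ _) _.
  have := le_trans (pf k c cmM) (NP k Nk).
  have := le_trans (pf l c cmM) (NP l Nl); lra.
exists X, p; split.
  apply/cvg_uniform_horner => e /small[N NP]; exists N => k Nk c sc.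
  exact: le_trans (pf k c (bounds_spectrum bT sc)) (NP k Nk).
by apply/cvg_to0P => // k; exact: opnorm_ge0.
Qed.

(** The polynomial p is compared with the polynomials witnessing [is_cfc] for the chosen value, so
    the choice made by [xget] becomes irrelevant: later proofs use only this bound. *)
Lemma cfc_error m M T f p e : bounds m M T -> polynomially_approximable m M f ->
  (forall c, m <= c <= M -> `|p.[c] - f c| <= e) -> 0 <= e ->
  opnorm (op_horner p T - cfc f T) <= e.
Proof.
move=> bT af pe e0.
have [q [/cvg_uniform_horner qf qX]] : is_cfc f T (cfc f T).
  by apply: xgetPex; exact: is_cfc_exists bT af.
apply/ler_addgt0Pr => d d0; have d20 : 0 < d / 2 by lra.
have [N1 N1P] := qf _ d20.
have [N2 N2P] := proj1 (cvg_to0P (fun k => opnorm_ge0 _)) qX _ d20.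
pose k := maxn N1 N2.
apply: le_trans (opnorm_triangle _ _ (op_horner (q k) T)) _.
have h2 := N2P k (leq_maxr _ _).
have h1 : opnorm (op_horner p T - op_horner (q k) T) <= e + d / 2.
  rewrite -op_hornerB; apply: opnorm_horner => [||c sc].
  - exact: bounds_selfadjoint bT.
  - by rewrite addr_ge0// ltW.
  - rewrite hornerD hornerN.
    have -> : p.[c] - (q k).[c] = (p.[c] - f c) - ((q k).[c] - f c) by ring.
    apply: le_trans (ler_normB _ _) _; apply: lerD.
      exact/pe/(bounds_spectrum bT).
    exact: N1P (leq_maxl _ _) _ sc.
lra.
Qed.

End Cfc.

(** * Closure properties of polynomial approximability *)

Section Approximable.
Context {R : realType}.
Implicit Types (c e m M : R) (p q : {poly R}) (f g : R -> R).

Lemma poly_bounded m M p : exists2 K : R, 0 <= K &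
  forall c, m <= c <= M -> `|p.[c]| <= K.
Proof.
elim/poly_ind: p => [|p a [K K0 pK]].
  by exists 0 => // c _; rewrite horner0 normr0.
exists (K * (`|m| + `|M|) + `|a|).
  by rewrite addr_ge0 ?mulr_ge0 ?addr_ge0.
move=> c cmM; rewrite hornerMXaddC; apply: le_trans (ler_normD _ _) _.
rewrite lerD2r normrM; apply: ler_pM => //; first exact: pK.
case/andP: cmM => mc cM; rewrite ler_norml; apply/andP.
have := ler_norm (- m); have := ler_norm M; rewrite normrN.
by have := normr_ge0 m; have := normr_ge0 M; split; lra.
Qed.

Lemma approximable_bounded m M f : polynomially_approximable m M f ->
  exists2 K : R, 0 <= K & forall c, m <= c <= M -> `|f c| <= K.
Proof.
move=> af; have [p pf] := af 1 ltr01; have [K K0 pK] := poly_bounded m M p.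
exists (K + 1) => [|c cmM]; first by rewrite addr_ge0.
have -> : f c = p.[c] - (p.[c] - f c) by rewrite opprB addrC subrK.
by apply: le_trans (ler_normB _ _) _; rewrite lerD ?pK ?pf.
Qed.

Lemma approximable_cst m M a : polynomially_approximable m M (fun _ => a).
Proof. by move=> e e0; exists a%:P => c _; rewrite hornerC subrr normr0 ltW. Qed.

Lemma approximable_id m M : polynomially_approximable m M id.
Proof. by move=> e e0; exists 'X => c _; rewrite hornerX subrr normr0 ltW. Qed.

Lemma approximableD m M f g : polynomially_approximable m M f ->
  polynomially_approximable m M g ->
  polynomially_approximable m M (fun c => f c + g c).
Proof.
move=> af ag e e0; have e20 : 0 < e / 2 by lra.
have [p pf] := af _ e20; have [q qg] := ag _ e20; exists (p + q) => c cmM.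
rewrite hornerD opprD addrACA; apply: le_trans (ler_normD _ _) _.
have := pf c cmM; have := qg c cmM; lra.
Qed.

Lemma approximationM m M f g e : polynomially_approximable m M f ->
  polynomially_approximable m M g -> 0 < e ->
  exists2 d, 0 < d & forall p q,
    (forall c, m <= c <= M -> `|p.[c] - f c| <= d) ->
    (forall c, m <= c <= M -> `|q.[c] - g c| <= d) ->
    forall c, m <= c <= M -> `|(p * q).[c] - f c * g c| <= e.
Proof.
move=> af ag e0.
have [F F0 fF] := approximable_bounded af.
have [G G0 gG] := approximable_bounded ag.
(* With |f| <= F and |g| <= G, the error of the product is at most d^2 + d G + F d, hence at most d
   (F + G + 1) once d <= 1. *)
pose d := Num.min 1 (e / (F + G + 1)).
have K0 : 0 < F + G + 1 by lra.
have d0 : 0 < d by rewrite lt_min ltr01 divr_gt0.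
exists d => // p q pf qg c cmM; rewrite hornerM.
have -> : p.[c] * q.[c] - f c * g c =
    (p.[c] - f c) * (q.[c] - g c) + (p.[c] - f c) * g c + f c * (q.[c] - g c).
  by ring.
have d1 : d <= 1 by rewrite ge_min lexx.
have dK : d * (F + G + 1) <= e by rewrite -ler_pdivlMr// ge_min lexx orbT.
apply: le_trans (ler_normD _ _) _.
apply: le_trans (lerD (ler_normD _ _) (lexx _)) _; rewrite !normrM.
have h1 := ler_pM (normr_ge0 _) (normr_ge0 _) (pf c cmM) (qg c cmM).
have h2 := ler_pM (normr_ge0 _) (normr_ge0 _) (pf c cmM) (gG c cmM).
have h3 := ler_pM (normr_ge0 _) (normr_ge0 _) (fF c cmM) (qg c cmM).
by nra.
Qed.

Lemma approximableM m M f g : polynomially_approximable m M f ->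
  polynomially_approximable m M g ->
  polynomially_approximable m M (fun c => f c * g c).
Proof.
move=> af ag e e0; have [d d0 pq] := approximationM af ag e0.
have [p pf] := af _ d0; have [q qg] := ag _ d0; exists (p * q).
exact: pq.
Qed.

End Approximable.

(** * Algebra of the functional calculus *)

Section CfcTheory.
Context {R : realType} {H : hilbertType R}.
Implicit Types (x y z : H) (a b c e m M : R)
  (S T X Y C : operator H).
Implicit Types (p q : {poly R}) (f g : R -> R).

(** All passages to the limit go through this lemma. The approximant S cancels from the asymmetry of
    X because S is symmetric, so only S - X has to be estimated; a negative value of the form of X
    is excluded by approximating to within half of it. *)
Lemma positive_closed X :
  (forall e, 0 < e -> exists2 S, positive S & opnorm (S - X) <= e) ->
  positive X.
Proof.
move=> h; apply/positiveP; split=> [|x].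
  apply/selfadjointP => x y; apply/eqP; rewrite -subr_eq0 -normr_le0.
  apply/ler_addgt0Pr => e e0; rewrite add0r.
  pose K := 2 * (nrm x * nrm y) + 1.
  have xy0 : 0 <= nrm x * nrm y by rewrite mulr_ge0 ?nrm_ge0.
  have K0 : 0 < K by rewrite /K; lra.
  have [S pS SX] := h _ (divr_gt0 e0 K0).
  have sS := positive_selfadjoint pS.
  have -> : ip (X x) y - ip x (X y) = ip x ((S - X) y) - ip ((S - X) x) y.
    by rewrite /= !ipE (selfadjoint_ip _ _ sS); ring.
  apply: le_trans (ler_normB _ _) _.
  have h1 := CauchySchwarz_nrm x ((S - X) y).
  have h2 := CauchySchwarz_nrm ((S - X) x) y.
  have h3 := opnormP (S - X) x; have h4 := opnormP (S - X) y.
  have h5 := ler_wpM2l (nrm_ge0 x) h4; have h6 := ler_wpM2r (nrm_ge0 y) h3.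
  have h7 := ler_wpM2r xy0 SX.
  have h8 : e / K * K = e by rewrite divfK// gt_eqF.
  have h9 : 0 < e / K by rewrite divr_gt0.
  move: (e / K) h8 h9 h7 h5 h6; rewrite /K => d h8 h9 h7 h5 h6.
  by nra.
rewrite leNgt; apply/negP => Xx.
have x0 : 0 < ip x x + 1 by rewrite ltr_wpDl ?ip_ge0.
have [|S pS SX] := h (- ip (X x) x / 2 / (ip x x + 1)).
  by rewrite !divr_gt0// oppr_gt0.
have h1 := ip_opnorm (S - X) x.
have h2 := ler_wpM2r (ip_ge0 x) SX.
have h3 : - ip (X x) x / 2 / (ip x x + 1) * ip x x <= - ip (X x) x / 2.
  by rewrite mulrAC ler_pdivrMr// ler_wpM2l ?lerDl//; lra.
have h4 := positive_ip x pS.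
have := le_trans (ler_norm _) (le_trans h1 (le_trans h2 h3)).
by rewrite /= !ipE; lra.
Qed.

Lemma bounds_weaken m M m' M' T : m' <= m -> M <= M' ->
  bounds m M T -> bounds m' M' T.
Proof.
move=> mm MM [p1 p2]; split.
  exact: positive_trans p1 (positive_ZB mm).
exact: positive_trans (positive_ZB MM) p2.
Qed.

Context {m M : R} {T : operator H} (bT : bounds m M T).

(** A single polynomial must be near [f] and near [X] at once, so identities pass from [op_horner]
    to [cfc] by exhibiting the polynomial. *)
Lemma cfc_unique f X :
  (forall e, 0 < e -> exists2 p, forall c, m <= c <= M -> `|p.[c] - f c| <= e &
    opnorm (op_horner p T - X) <= e) -> cfc f T = X.
Proof.
move=> h; apply: opnorm_eq => e e0; have e20 : 0 < e / 2 by lra.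
have af : polynomially_approximable m M f.
  by move=> d d0; have [p pf _] := h d d0; exists p.
have [p pf pX] := h _ e20.
apply: le_trans (opnorm_triangle _ _ (op_horner p T)) _.
rewrite opnormB; have := cfc_error bT af pf (ltW e20); lra.
Qed.

Lemma eq_cfc f g : polynomially_approximable m M f ->
  (forall c, m <= c <= M -> f c = g c) -> cfc f T = cfc g T.
Proof.
move=> af fg; apply/esym/cfc_unique => e e0; have [p pf] := af _ e0.
exists p; first by move=> c cmM; rewrite -fg// pf.
exact: cfc_error bT af pf (ltW e0).
Qed.

Lemma cfc_horner p : cfc (horner p) T = op_horner p T.
Proof.
apply: cfc_unique => e e0; exists p => [c _|];
  by rewrite subrr ?normr0 ?opnorm0 ltW.
Qed.

Lemma cfcD f g : polynomially_approximable m M f ->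
  polynomially_approximable m M g ->
  cfc (fun c => f c + g c) T = cfc f T + cfc g T.
Proof.
move=> af ag; apply: cfc_unique => e e0; have e20 : 0 < e / 2 by lra.
have [p pf] := af _ e20; have [q qg] := ag _ e20; exists (p + q) => [c cmM|].
  rewrite hornerD opprD addrACA; apply: le_trans (ler_normD _ _) _.
  have := pf c cmM; have := qg c cmM; lra.
rewrite op_hornerD opprD addrACA; apply: le_trans (opnormD _ _) _.
have := cfc_error bT af pf (ltW e20); have := cfc_error bT ag qg (ltW e20); lra.
Qed.

Lemma cfcM f g : polynomially_approximable m M f ->
  polynomially_approximable m M g ->
  cfc (fun c => f c * g c) T = cfc f T * cfc g T.
Proof.
move=> af ag; apply: cfc_unique => e e0.
have [d d0 pq] := approximationM af ag e0.
(* The same splitting of a product error as for functions, now with operator norms in place of the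
   suprema. *)
pose K := opnorm (cfc f T) + opnorm (cfc g T) + 1.
have K0 : 0 < K by rewrite ltr_wpDl ?addr_ge0 ?opnorm_ge0.
pose d' := Num.min d (Num.min 1 (e / K)).
have d'0 : 0 < d' by rewrite !lt_min d0 ltr01 divr_gt0.
have d'd : d' <= d by rewrite ge_min lexx.
have d'1 : d' <= 1 by rewrite !ge_min lexx orbT.
have d'K : d' * K <= e by rewrite -ler_pdivlMr// !ge_min lexx !orbT.
have [p pf] := af _ d'0; have [q qg] := ag _ d'0; exists (p * q).
  apply: pq => c cmM; [exact: le_trans (pf c cmM) d'd|].
  exact: le_trans (qg c cmM) d'd.
have hp := cfc_error bT af pf (ltW d'0).
have hq := cfc_error bT ag qg (ltW d'0).
rewrite op_hornerM; move: hp hq; rewrite /K in d'K.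
move: (op_horner p T) (op_horner q T) (cfc f T) (cfc g T) d'K.
move=> P Q F G d'K hp hq.
have -> : P * Q - F * G = (P - F) * (Q - G) + (P - F) * G + F * (Q - G).
  by rewrite -mulrDr subrK mulrBl mulrBr addrA subrK.
apply: le_trans (opnormD _ _) _.
apply: le_trans (lerD (opnormD _ _) (lexx _)) _.
have h1 := opnormM (P - F) (Q - G); have h2 := opnormM (P - F) G.
have h3 := opnormM F (Q - G).
have := opnorm_ge0 (P - F); have := opnorm_ge0 (Q - G).
have := opnorm_ge0 F; have := opnorm_ge0 G; nra.
Qed.

End CfcTheory.

(* Keeps unification and [lra] from unfolding operators when they compare
   distinct ones. *)
Local Opaque cfc opnorm op_horner.

(** * Order, composition and intertwining in the functional calculus *)

Section CfcOrder.
Context {R : realType} {H : hilbertType R}.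
Implicit Types (x y z : H) (a b c e m M : R)
  (S T X Y C D : operator H).
Implicit Types (p q : {poly R}) (f g : R -> R).

Section OneOperator.
Context {m M : R} {T : operator H} (bT : bounds m M T).

Lemma cfc_cst a : cfc (fun _ => a) T = a%:O.
Proof.
rewrite -(op_hornerC a T) -(cfc_horner bT); apply: (eq_cfc bT).
  exact: approximable_cst.
by move=> c _; rewrite hornerC.
Qed.

Lemma cfc_id : cfc id T = T.
Proof.
rewrite -{2}(op_hornerX T) -(cfc_horner bT); apply: (eq_cfc bT).
  exact: approximable_id.
by move=> c _; rewrite hornerX.
Qed.

Lemma cfcZ a f : polynomially_approximable m M f ->
  cfc (fun c => a * f c) T = a%:C *: cfc f T.
Proof.
move=> af; rewrite (cfcM bT (approximable_cst m M a) af) cfc_cst.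
by rewrite opscaleAl mul1r.
Qed.

Lemma approximableZ a f : polynomially_approximable m M f ->
  polynomially_approximable m M (fun c => a * f c).
Proof. by move=> af; exact: approximableM (approximable_cst m M a) af. Qed.

Lemma opnorm_cfc f e : polynomially_approximable m M f -> 0 <= e ->
  (forall c, m <= c <= M -> `|f c| <= e) -> opnorm (cfc f T) <= e.
Proof.
move=> af e0 fe; have := cfc_error (p := 0) bT af _ e0.
rewrite op_hornerC rmorph0 scale0r sub0r opnormN; apply => c cmM.
by rewrite horner0 sub0r normrN fe.
Qed.

(** A polynomial within e / 2 of f, raised by e / 2, is nonnegative on [m, M] and still within e of
    f. *)
Lemma cfc_positive f : polynomially_approximable m M f ->
  (forall c, m <= c <= M -> 0 <= f c) -> positive (cfc f T).
Proof.
move=> af f0; apply: positive_closed => e e0; have e20 : 0 < e / 2 by lra.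
have [p pf] := af _ e20; exists (op_horner (p + (e / 2)%:P) T).
  apply: positive_horner => [|c sc]; first exact: bounds_selfadjoint bT.
  have cmM := bounds_spectrum bT sc; rewrite hornerD hornerC.
  by have := pf c cmM; rewrite ler_norml => /andP[h _]; have := f0 c cmM; lra.
apply: (cfc_error bT af) (ltW e0) => c cmM.
rewrite hornerD hornerC addrAC; apply: le_trans (ler_normD _ _) _.
by have := pf c cmM; rewrite (gtr0_norm e20); lra.
Qed.

Lemma cfc_le f g : polynomially_approximable m M f ->
  polynomially_approximable m M g ->
  (forall c, m <= c <= M -> f c <= g c) -> positive (cfc g T - cfc f T).
Proof.
move=> af ag fg.
have -> : cfc g T - cfc f T = cfc (fun c => g c + -1 * f c) T.
  rewrite (cfcD bT)// ?cfcZ ?rmorphN1 ?scaleN1r//; exact: approximableZ.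
apply: cfc_positive => [|c cmM]; last by rewrite mulN1r subr_ge0 fg.
by apply: approximableD => //; exact: approximableZ.
Qed.

Lemma cfc_bounds f m' M' : polynomially_approximable m M f ->
  (forall c, m <= c <= M -> m' <= f c <= M') -> bounds m' M' (cfc f T).
Proof.
move=> af fb; split.
  rewrite -cfc_cst; apply: cfc_le => // [|c /fb/andP[]//].
  exact: approximable_cst.
rewrite -cfc_cst; apply: cfc_le => // [|c /fb/andP[]//].
exact: approximable_cst.
Qed.

(** The two conclusions are proved together because each step of the induction on p applies [cfcM]
    and [cfcD], which require the approximability of the previous stage. *)
Lemma cfc_comp_horner f p : polynomially_approximable m M f ->
  polynomially_approximable m M (fun c => p.[f c]) /\
  cfc (fun c => p.[f c]) T = op_horner p (cfc f T).
Proof.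
move=> af; elim/poly_ind: p => [|p a [IH1 IH2]].
  have h : polynomially_approximable m M (fun c => (0 : {poly R}).[f c]).
    move=> e e0; exists 0 => c _; rewrite !horner0 subrr normr0; exact: ltW.
  split=> //; rewrite op_hornerC -cfc_cst; apply: (eq_cfc bT) => // c _.
  by rewrite horner0.
have h1 := approximableM IH1 af; have h2 := approximable_cst m M a.
have e c : (p * 'X + a%:P).[f c] = p.[f c] * f c + a by rewrite hornerMXaddC.
have h : polynomially_approximable m M (fun c => (p * 'X + a%:P).[f c]).
  move=> d d0; have [q qf] := approximableD h1 h2 d0; exists q => c cmM.
  by rewrite e; exact: qf.
split=> //; rewrite op_hornerD op_hornerMX op_hornerC -IH2 -cfc_cst.
rewrite -(cfcM bT)// -(cfcD bT)//; exact: (eq_cfc bT).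
Qed.

Lemma cfc_comp f g m' M' : polynomially_approximable m M f ->
  (forall c, m <= c <= M -> m' <= f c <= M') ->
  polynomially_approximable m' M' g ->
  polynomially_approximable m M (g \o f) ->
  cfc g (cfc f T) = cfc (g \o f) T.
Proof.
move=> af fb ag agf; apply: opnorm_eq => e e0; have e20 : 0 < e / 2 by lra.
have [q qg] := ag _ e20; have bX := cfc_bounds af fb.
have [aq qX] := cfc_comp_horner q af.
apply: le_trans (opnorm_triangle _ _ (op_horner q (cfc f T))) _.
have h1 := cfc_error bX ag qg (ltW e20).
have h2 : opnorm (op_horner q (cfc f T) - cfc (g \o f) T) <= e / 2.
  have -> : op_horner q (cfc f T) - cfc (g \o f) T =
      cfc (fun c => q.[f c] + -1 * (g \o f) c) T.
    rewrite (cfcD bT)// ?cfcZ ?rmorphN1 ?scaleN1r ?qX//; exact: approximableZ.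
  apply: opnorm_cfc => [||c /fb/qg]; rewrite ?mulN1r ?(ltW e20)//.
  by apply: approximableD => //; exact: approximableZ.
by rewrite opnormB; apply: le_trans (lerD h1 h2) _; rewrite -splitr.
Qed.

End OneOperator.

(** For polynomials this is [op_horner_swap]. The intertwiner D is arbitrary, as it will be the
    product X Y, which need not be self-adjoint. *)
Lemma cfc_swap m M S T D f : bounds m M S -> bounds m M T ->
  polynomially_approximable m M f -> S * D = D * T ->
  cfc f S * D = D * cfc f T.
Proof.
move=> bS bT af SD; apply: opnorm_eq => e e0.
pose K := 2 * opnorm D + 1.
have K0 : 0 < K by rewrite /K; have := opnorm_ge0 D; lra.
have d0 := divr_gt0 e0 K0; have [p pf] := af _ d0.
have hS := cfc_error bS af pf (ltW d0); have hT := cfc_error bT af pf (ltW d0).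
have -> : cfc f S * D - D * cfc f T =
    - (op_horner p S - cfc f S) * D + D * (op_horner p T - cfc f T).
  rewrite opprB mulrBl mulrBr -(op_horner_swap p SD) addrA subrK.
  by [].
apply: le_trans (opnormD _ _) _.
have h1 := opnormM (- (op_horner p S - cfc f S)) D; rewrite opnormN in h1.
have h2 := opnormM D (op_horner p T - cfc f T).
have D0 := opnorm_ge0 D; apply: le_trans (lerD h1 h2) _.
apply: le_trans (lerD (ler_wpM2r D0 hS) (ler_wpM2l D0 hT)) _.
have : e / K * K = e by rewrite divfK// gt_eqF.
move: (e / K) d0 {hS hT h1 h2}; rewrite /K; move: (opnorm D) => o d d0 <-.
lra.
Qed.

Lemma posdefP T : posdef T <-> exists m M, [/\ 0 < m, m <= M & bounds m M T].
Proof.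
split=> [[pT iT]|[m [M [m0 mM [pm pM]]]]].
  have [m m0 Tm] := positive_lower_bound pT iT.
  have sT := positive_selfadjoint pT.
  have sO c := selfadjointZ c (@selfadjoint1 R H).
  (* The maximum secures m <= M on the zero space, where the norm of T is 0. *)
  exists m, (Num.max m (opnorm T)); split; rewrite ?le_max ?lexx//; split.
    apply/positiveP; split=> [|x]; first exact: selfadjointB.
    by have := Tm x; rewrite /= !ipE subr_ge0.
  by apply: positive_opnorm; rewrite // le_max lexx orbT.
have pT : positive T.
  have := positiveD pm (positiveZ (ltW m0) positive1); by rewrite subrK.
split=> //; apply: (@invertible_lower_bound _ _ _ m) => // [|x].
  exact: positive_selfadjoint.
by have := positive_ip x pm; rewrite /= !ipE subr_ge0.
Qed.

End CfcOrder.

(* A sealed copy of [op_power]: otherwise unification unfolds [op_power] down to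
   its definition by [xget] each time it compares two distinct powers. *)
HB.lock Definition opow {R : realType} {H : hilbertType R} (T : operator H)
  (a : R) : operator H := op_power T a.


(** * Real powers of positive definite operators *)

Section Powers.
Local Notation "X `^^ a" := (opow X a) : ring_scope.
Context {R : realType} {H : hilbertType R}.
Implicit Types (x y z : H) (a b c e m M : R)
  (S T X Y C D : operator H).

Lemma opowE T a : opow T a = cfc (fun c => c `^ a) T.
Proof. by rewrite opow.unlock. Qed.

Lemma powR_bounds m M a : 0 < m -> m <= M -> exists m' M',
  [/\ 0 < m', m' <= M' & forall c, m <= c <= M -> m' <= c `^ a <= M'].
Proof.
move=> m0 mM.
exists (Num.min (m `^ a) (M `^ a)), (Num.max (m `^ a) (M `^ a)).
have M0 : 0 < M by lra.
split; first by rewrite lt_min !powR_gt0.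
  by rewrite ge_min le_max lexx.
move=> c /andP[mc cM]; have c0 : 0 < c by lra.
have h u v : 0 < u -> 0 < v -> (u `^ a <= v `^ a) = (a * ln u <= a * ln v).
  by move=> u0 v0; rewrite /powR !gt_eqF// ler_expR.
rewrite ge_min le_max !h//.
have h1 : ln m <= ln c by rewrite ler_ln ?posrE.
have h2 : ln c <= ln M by rewrite ler_ln ?posrE.
have [a0|/ltW a0] := leP 0 a; apply/andP; split; apply/orP.
- by left; exact: ler_wpM2l.
- by right; exact: ler_wpM2l.
- by right; exact: ler_wnM2l.
- by left; exact: ler_wnM2l.
Qed.

Lemma op_power_bounds T a m M : 0 < m -> m <= M -> bounds m M T ->
  exists m' M', [/\ 0 < m', m' <= M', bounds m' M' (T `^^ a) &
    forall c, m <= c <= M -> m' <= c `^ a <= M'].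
Proof.
move=> m0 mM bT; have [m' [M' [m'0 mM' h]]] := powR_bounds a m0 mM.
exists m', M'; split=> //; rewrite opowE.
by apply: (cfc_bounds bT) => //; exact: powR_approximable.
Qed.

Lemma posdef_power T a : posdef T -> posdef (T `^^ a).
Proof.
move=> /posdefP[m [M [m0 mM bT]]].
have [m' [M' [m'0 mM' bX _]]] := op_power_bounds a m0 mM bT.
by apply/posdefP; exists m', M'.
Qed.

Lemma op_powerD T a b : posdef T -> T `^^ (a + b) = T `^^ a * T `^^ b.
Proof.
move=> /posdefP[m [M [m0 mM bT]]].
rewrite !opowE -(cfcM bT); [|exact: powR_approximable..].
apply: (eq_cfc bT) => [|c /andP[mc _]]; first exact: powR_approximable.
by rewrite powRD// (gt_eqF (lt_le_trans m0 mc)) implybT.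
Qed.

Lemma op_power0 T : posdef T -> T `^^ 0 = 1.
Proof.
move=> /posdefP[m [M [m0 mM bT]]].
rewrite opowE -[RHS]scale1r -(rmorph1 (real_complex R)) -(cfc_cst bT).
apply: (eq_cfc bT) => [|c /andP[mc _]]; first exact: powR_approximable.
by rewrite powRr0.
Qed.

Lemma op_power1 T : posdef T -> T `^^ 1 = T.
Proof.
move=> /posdefP[m [M [m0 mM bT]]]; rewrite opowE -[RHS](cfc_id bT).
apply: (eq_cfc bT) => [|c /andP[mc _]]; first exact: powR_approximable.
by rewrite powRr1//; lra.
Qed.

Lemma op_powerM T a b : posdef T -> (T `^^ a) `^^ b = T `^^ (a * b).
Proof.
move=> /posdefP[m [M [m0 mM bT]]].
have [m' [M' [m'0 mM' _ h]]] := op_power_bounds a m0 mM bT.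
have e c : (c `^ a) `^ b = c `^ (a * b) by rewrite powRrM.
have agf : polynomially_approximable m M
    ((fun c => c `^ b) \o (fun c => c `^ a)).
  move=> d d0; have [q qf] := @powR_approximable R m M (a * b) m0 d d0.
  by exists q => c /qf; rewrite /= e.
rewrite !opowE (cfc_comp bT (powR_approximable M a m0) h _ agf).
  by apply: (eq_cfc bT) => // c _; exact: e.
exact: powR_approximable.
Qed.

Lemma op_powerN T a : posdef T -> T `^^ (- a) * T `^^ a = 1.
Proof. by move=> pT; rewrite -op_powerD// addNr op_power0. Qed.

Lemma op_powerVN T a : posdef T -> T `^^ a * T `^^ (- a) = 1.
Proof. by move=> pT; rewrite -op_powerD// subrr op_power0. Qed.

Lemma op_power_nat T k : posdef T -> T `^^ k%:R = T ^+ k.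
Proof.
move=> pT; elim: k => [|k IH]; first by rewrite op_power0// expr0.
by rewrite -addn1 natrD op_powerD// IH op_power1// exprD expr1.
Qed.

Lemma op_power_swap S T D a : posdef S -> posdef T -> S * D = D * T ->
  S `^^ a * D = D * T `^^ a.
Proof.
move=> /posdefP[m [M [m0 mM bS]]] /posdefP[m' [M' [m'0 mM' bT]]] SD.
pose l := Num.min m m'; pose L := Num.max M M'.
have l0 : 0 < l by rewrite lt_min m0.
have bS' : bounds l L S.
  by apply: bounds_weaken bS; rewrite ?ge_min ?le_max lexx.
have bT' : bounds l L T.
  by apply: bounds_weaken bT; rewrite ?ge_min ?le_max lexx orbT.
rewrite !opowE; exact: cfc_swap bS' bT' (powR_approximable L a l0) SD.
Qed.

Lemma posdef_selfadjoint T : posdef T -> selfadjoint T.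
Proof. by move=> [/positive_selfadjoint]. Qed.

Lemma power_selfadjoint T a : posdef T -> selfadjoint (T `^^ a).
Proof. by move=> pT; exact/posdef_selfadjoint/posdef_power. Qed.

Lemma opinv_unique T S : is_inverse T S -> opinv T = S.
Proof.
move=> iS; have iT : is_inverse T (opinv T) by apply: xgetPex; exists S.
case: iS iT => [ST TS] [T'T TT'].
by rewrite -[LHS]mul1r -ST -mulrA TT' mulr1.
Qed.

Lemma opinv_power T : posdef T -> opinv T = T `^^ (-1).
Proof.
move=> pT; apply: opinv_unique.
by have := op_powerN 1 pT; have := op_powerVN 1 pT; rewrite op_power1.
Qed.

End Powers.

(** * Operator monotonicity *)

Section Monotonicity.
Local Notation "X `^^ a" := (opow X a) : ring_scope.
Context {R : realType} {H : hilbertType R}.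
Implicit Types (x y z : H) (a b c d e h m M p r : R)
  (S T X Y Z C D G A B : operator H).

Lemma posdef_conj C T : posdef C -> posdef T -> posdef (C * T * C).
Proof.
move=> pC [pT iT]; split.
  by apply: positive_conj => //; exact: posdef_selfadjoint.
by case: pC => _ iC; do 2 apply: invertibleM => //.
Qed.

Lemma ge_conj C X Y : selfadjoint C -> positive (X - Y) ->
  positive (C * X * C - C * Y * C).
Proof. by move=> sC XY; rewrite -mulrBl -mulrBr; exact: positive_conj. Qed.

Lemma power_inv_unique Z S : posdef Z -> S * Z = 1 -> S = Z `^^ (-1).
Proof.
move=> pZ SZ; rewrite -[S]mulr1 -(op_powerVN 1 pZ) mulrA op_power1// SZ.
by rewrite mul1r.
Qed.

Lemma inverse_conj C Y : posdef C -> posdef Y ->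
  (C * Y * C) `^^ (-1) = C `^^ (-1) * Y `^^ (-1) * C `^^ (-1).
Proof.
move=> pC pY; apply/esym/power_inv_unique; first exact: posdef_conj.
have hC := op_powerN 1 pC; have hY := op_powerN 1 pY.
rewrite op_power1// in hC; rewrite op_power1// in hY.
move: (C `^^ (-1)) (Y `^^ (-1)) hC hY => P Q hC hY.
by rewrite !mulrA -[P * Q * P * C]mulrA hC mulr1 -[P * Q * Y]mulrA hY mulr1.
Qed.

Lemma power_half_conj X : posdef X ->
  X `^^ (- (1 / 2)) * X * X `^^ (- (1 / 2)) = 1.
Proof.
move=> pX; transitivity (X `^^ (- (1 / 2) + 1 + - (1 / 2))).
  by rewrite !op_powerD// op_power1.
have -> : - (1 / 2) + 1 + - (1 / 2) = 0 :> R by lra.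
exact: op_power0.
Qed.

(** Conjugation by X^(-1/2) reduces to Z <= 1 with Z = X^(-1/2) Y X^(-1/2). Conjugation by Z^(-1/2)
    gives 1 <= Z^(-1), and a last conjugation by X^(-1/2) undoes the first. *)
Lemma inverse_antitone X Y : posdef X -> posdef Y -> positive (X - Y) ->
  positive (Y `^^ (-1) - X `^^ (-1)).
Proof.
move=> pX pY XY.
pose C := X `^^ (- (1 / 2)); have pC : posdef C by exact: posdef_power.
have XC : C * X * C = 1 by exact: power_half_conj.
have CC : C * C = X `^^ (-1).
  by rewrite -op_powerD//; congr (_ `^^ _); lra.
pose Z := C * Y * C; have pZ : posdef Z by exact: posdef_conj.
have Z1 : positive (1 - Z).
  by rewrite -XC; apply: ge_conj => //; exact: posdef_selfadjoint.
pose E := Z `^^ (- (1 / 2)); have pE : posdef E by exact: posdef_power.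
have := ge_conj (posdef_selfadjoint pE) Z1.
have -> : E * Z * E = 1 by exact: power_half_conj.
have EE : E * E = Z `^^ (-1).
  by rewrite /E -(op_powerD _ _ pZ); congr (_ `^^ _); lra.
rewrite mulr1 EE => /(ge_conj (posdef_selfadjoint pC)).
rewrite (mulr1 C) CC (inverse_conj pC pY).
have := op_powerVN 1 pC; have := op_powerN 1 pC; rewrite op_power1//.
move: (C `^^ (-1)) (Y `^^ (-1)) => P Q PC CP.
by rewrite !mulrA CP mul1r -mulrA PC mulr1.
Qed.

(* Otherwise m := inf (G1 - G2) < 0 is approximated by unit vectors x with
   (G1 - G2) x close to m x, and <(G1^2 - G2^2) x, x> = Re <(G1 - G2) x, (G1 +
   G2) x> would be close to m <(G1 + G2) x, x>. *)
Lemma sqr_ge_inv G1 G2 : posdef G1 -> posdef G2 ->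
  positive (G1 * G1 - G2 * G2) -> positive (G1 - G2).
Proof.
move=> p1 p2 GG; have s1 := posdef_selfadjoint p1.
have s2 := posdef_selfadjoint p2; have sD := selfadjointB s1 s2.
apply/positiveP; split=> // x0; rewrite leNgt; apply/negP => Dx0.
have x0n : x0 != 0 by apply: contraTneq Dx0 => ->; rewrite ip0r ltxx.
have [m [Dm _]] := numerical_infimum sD x0n; apply.
have m0 : m < 0.
  have x0p : 0 < ip x0 x0.
    rewrite ip_nrm exprn_gt0// lt_neqAle nrm_ge0 eq_sym andbT.
    by apply: contra_neq x0n; exact: nrm_eq0.
  by rewrite -(pmulr_llt0 _ x0p); exact: le_lt_trans (Dm x0) Dx0.
have [g g0 G1g] := positive_lower_bound (proj1 p1) (proj2 p1).
pose S := G1 - G2 - m%:O; pose K := G1 + G2.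
have sS : selfadjoint S.
  by apply: selfadjointB => //; apply: selfadjointZ; exact: selfadjoint1.
have pS : positive S.
  by apply/positiveP; split=> // x; have := Dm x; rewrite /= !ipE; lra.
pose k := opnorm K + 1; pose s := opnorm S + 1.
have k0 : 0 < k by rewrite ltr_wpDl ?opnorm_ge0.
have s0 : 0 < s by rewrite ltr_wpDl ?opnorm_ge0.
pose w := - m * g / k; have w0 : 0 < w by rewrite !divr_gt0 ?mulr_gt0 ?oppr_gt0.
apply: (@invertible_lower_bound _ _ _ (w ^+ 2 / s)) => // [|x].
  by rewrite divr_gt0// exprn_gt0.
rewrite -/S mulrAC ler_pdivrMr// [leRHS]mulrC.
have Sx : nrm (S x) ^+ 2 <= s * ip (S x) x.
  rewrite -ip_nrm; apply: le_trans (positive_norm_sqr x pS) _.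
  by rewrite ler_wpM2r ?positive_ip ?lerDl.
apply: le_trans Sx; rewrite ip_nrm -exprMn ler_sqr; last 2 first.
- by rewrite nnegrE mulr_ge0 ?nrm_ge0// ltW.
- by rewrite nnegrE nrm_ge0.
have [->|xn] := eqVneq x 0; first by rewrite nrm0 mulr0 nrm_ge0.
have xp : 0 < nrm x.
  rewrite lt_neqAle nrm_ge0 eq_sym andbT.
  by apply: contra_neq xn; exact: nrm_eq0.
have GGx : ip ((G1 * G1 - G2 * G2) x) x = m * ip (K x) x + ip (S x) (K x).
  rewrite /= !ipE [ip (G1 (G1 x)) x](selfadjoint_ip _ _ s1).
  rewrite [ip (G2 (G2 x)) x](selfadjoint_ip _ _ s2) [ip (G1 x) x]ipC.
  by rewrite [ip (G2 x) x]ipC [ip (G2 x) (G1 x)]ipC; ring.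
have := positive_ip x GG; rewrite GGx => h1.
have h2 := le_trans (ler_norm _) (CauchySchwarz_nrm (S x) (K x)).
have h3 : nrm (K x) <= k * nrm x.
  by apply: le_trans (opnormP _ _) _; rewrite ler_wpM2r ?nrm_ge0 ?lerDl.
have h4 := ler_wpM2l (nrm_ge0 (S x)) h3.
have h5 : g * nrm x ^+ 2 <= ip (K x) x.
  have := G1g x; have := positive_ip x (proj1 p2).
  by rewrite -ip_nrm /K /= ipE; lra.
rewrite -(ler_pM2r (mulr_gt0 k0 xp)).
have -> : w * nrm x * (k * nrm x) = - m * (g * nrm x ^+ 2).
  by rewrite /w; field; rewrite gt_eqF.
have : - m * (g * nrm x ^+ 2) <= - m * ip (K x) x.
  by rewrite ler_wpM2l// oppr_ge0 ltW.
lra.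
Qed.

(** With W = A^(-a/2), the square of W A^c W is W A^b W, and the square of W B^c W is W B^c A^(-a)
    B^c W. Since A^(-a) <= B^(-a), the latter is at most W B^b W <= W A^b W. Now [sqr_ge_inv]
    compares the two operators and conjugation by A^(a/2) removes W. *)
Lemma power_midpoint A B a b : posdef A -> posdef B ->
  positive (A `^^ a - B `^^ a) -> positive (A `^^ b - B `^^ b) ->
  positive (A `^^ ((a + b) / 2) - B `^^ ((a + b) / 2)).
Proof.
move=> pA pB ABa ABb; set c := (a + b) / 2.
have pP X d : posdef X -> posdef (X `^^ d) by exact: posdef_power.
have sP X d : posdef X -> selfadjoint (X `^^ d) by exact: power_selfadjoint.
have BA : positive (B `^^ (- a) - A `^^ (- a)).
  have := inverse_antitone (pP _ a pA) (pP _ a pB) ABa.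
  rewrite (op_powerM _ _ pA) (op_powerM _ _ pB) (mulrN1 a); exact.
pose W := A `^^ (- a / 2); have pW : posdef W by exact: pP.
have WW : W * W = A `^^ (- a).
  by rewrite /W -(op_powerD _ _ pA); congr (_ `^^ _); lra.
pose V := A `^^ (a / 2); have sV : selfadjoint V by exact: sP.
have VW : V * W = 1.
  by rewrite /V /W -(op_powerD _ _ pA) mulNr addrN op_power0.
have WV : W * V = 1.
  by rewrite /V /W -(op_powerD _ _ pA) mulNr addNr op_power0.
have cA : A `^^ c * A `^^ (- a) * A `^^ c = A `^^ b.
  by rewrite -!(op_powerD _ _ pA); congr (_ `^^ _); rewrite /c; lra.
have cB : B `^^ c * B `^^ (- a) * B `^^ c = B `^^ b.
  by rewrite -!(op_powerD _ _ pB); congr (_ `^^ _); rewrite /c; lra.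
have pAc := pP A c pA; have pBc := pP B c pB.
have sW := posdef_selfadjoint pW; have sBc := posdef_selfadjoint pBc.
move: (A `^^ c) (B `^^ c) pAc pBc sBc cA cB => X Y pX pY sY cA cB.
move: W V pW sW sV WW VW WV => W V pW sW sV WW VW WV.
have G : positive (W * X * W - W * Y * W).
  apply: sqr_ge_inv; [exact: posdef_conj|exact: posdef_conj|].
  have sq Z : (W * Z * W) * (W * Z * W) = W * (Z * A `^^ (- a) * Z) * W.
    by rewrite -WW !mulrA.
  rewrite (sq X) (sq Y) cA; apply: (ge_conj sW).
  apply: positive_trans ABb _; rewrite -cB.
  exact: ge_conj.
have := ge_conj sV G.
have cW Z : V * (W * Z * W) * V = Z.
  by rewrite !mulrA VW mul1r -mulrA WV mulr1.
by rewrite (cW X) (cW Y).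
Qed.

(** The left-hand side is a single function of T, so a scalar Taylor bound on [m, M] transfers to
    the norm. Both signs of h are allowed, which serves continuity and inverse powers. *)
Lemma op_power_log_expansion T : posdef T -> exists2 d, 0 < d &
  exists2 C : R, 0 <= C & forall h, `|h| <= d ->
    opnorm (T `^^ h - 1 - h%:C *: cfc (@ln R) T) <= C * h ^+ 2.
Proof.
move=> /posdefP[m [M [m0 mM bT]]].
have al := ln_approximable M m0.
have [K K0 lK] := approximable_bounded al.
have K1 : 0 < 2 * (K + 1) by lra.
(* With |ln| <= K on [m, M], this keeps |h ln c| below 1/2, the range of [expR_taylor2]. *)
exists ((2 * (K + 1))^-1); first by rewrite invr_gt0.
exists (2 * K ^+ 2); first by rewrite mulr_ge0// sqr_ge0.
move=> h hK.
have ap := powR_approximable M h m0.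
have a1 := approximable_cst m M (-1 : R).
have aZ := approximableZ (- h) al.
have -> : T `^^ h - 1 - h%:C *: cfc (@ln R) T =
    cfc (fun c => c `^ h + -1 + (- h) * ln c) T.
  rewrite (cfcD bT (approximableD ap a1) aZ) (cfcD bT ap a1).
  by rewrite opowE (cfc_cst bT) (cfcZ bT)// !rmorphN/= rmorph1 scaleN1r scaleNr.
apply: (opnorm_cfc bT) => [||c cmM].
- exact: approximableD (approximableD ap a1) aZ.
- by apply: mulr_ge0 (sqr_ge0 h); apply: mulr_ge0 (sqr_ge0 K).
have c0 : 0 < c by case/andP: cmM; lra.
rewrite /powR gt_eqF// mulNr.
have hl : `|h * ln c| <= `|h| * K by rewrite normrM ler_wpM2l// lK.
have hh : `|h| * (2 * (K + 1)) <= 1 by rewrite -ler_pdivlMr// div1r.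
apply: le_trans (expR_taylor2 _) _.
  by apply: le_trans (ler_norm _) (le_trans hl _); have := normr_ge0 h; nra.
have : `|h * ln c| ^+ 2 <= (`|h| * K) ^+ 2.
  by rewrite ler_sqr ?nnegrE ?mulr_ge0.
rewrite exprMn !real_normK ?num_real//.
by move: (ln c) (h * ln c) => l hl'; lra.
Qed.

Lemma op_power_continuous T a e : posdef T -> 0 < e -> exists2 d, 0 < d &
  forall b, `|b - a| <= d -> opnorm (T `^^ b - T `^^ a) <= e.
Proof.
move=> pT e0; have [d d0 [C C0 dC]] := op_power_log_expansion pT.
set L := cfc _ T in dC.
pose P := opnorm (T `^^ a) + 1; pose K := C * d + opnorm L + 1.
have P0 : 0 < P by rewrite ltr_wpDl ?opnorm_ge0.
have K0 : 0 < K by rewrite ltr_wpDl// addr_ge0 ?opnorm_ge0// mulr_ge0// ltW.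
exists (Num.min d (e / (P * K))).
  by rewrite lt_min d0 divr_gt0// mulr_gt0.
move=> b; rewrite le_min => /andP[bd be].
have -> : T `^^ b - T `^^ a = T `^^ a * (T `^^ (b - a) - 1).
  by rewrite mulrBr -op_powerD// [a + _]addrC subrK mulr1.
apply: le_trans (opnormM _ _) _.
set h := b - a in bd be *.
have h1 : opnorm (T `^^ h - 1) <= K * `|h|.
  have -> : T `^^ h - 1 = (T `^^ h - 1 - h%:C *: L) + h%:C *: L by rewrite subrK.
  apply: le_trans (opnormD _ _) _.
  apply: le_trans (lerD (dC h bd) (opnormZ_le h L)) _.
  rewrite -[in C * _]real_normK ?num_real// /K.
  have := normr_ge0 h; have := opnorm_ge0 L.
  move: (opnorm L) `|h| bd => o k kd o0 k0.
  have := ler_wpM2l (mulr_ge0 C0 k0) kd; nra.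
move: be; rewrite ler_pdivlMr ?mulr_gt0// => be.
have h2 : opnorm (T `^^ a) <= P by rewrite lerDl.
apply: le_trans (ler_pM (opnorm_ge0 _) (opnorm_ge0 _) h2 h1) _.
by rewrite mulrA mulrC.
Qed.

(** An odd j makes j / 2^(k+1) the midpoint of two neighbours of level k; an even j belongs to level
    k already. *)
Lemma power_dyadic A B k j : posdef A -> posdef B -> positive (A - B) ->
  (j <= 2 ^ k)%N ->
  positive (A `^^ (j%:R / 2 ^+ k) - B `^^ (j%:R / 2 ^+ k)).
Proof.
move=> pA pB AB; elim: k j => [|k IH] j.
  rewrite expn0 expr0 divr1; case: j => [|[|//]] _.
    by rewrite !op_power0// subrr; exact: positive0.
  by rewrite !op_power1.
have p0 : 2 ^+ k != 0 :> R by rewrite expf_neq0// pnatr_eq0.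
rewrite -(odd_double_half j) expnS mul2n; case: (odd j) => /=.
  rewrite add1n ltn_double => ik.
  have := power_midpoint pA pB (IH _ (ltnW ik)) (IH _ ik).
  suff -> : (j./2%:R / 2 ^+ k + (j./2).+1%:R / 2 ^+ k) / 2 =
    (j./2).*2.+1%:R / 2 ^+ k.+1 :> R by exact.
  by rewrite exprS -addnn -!natr1 natrD; field.
rewrite add0n leq_double => ik.
suff -> : (j./2).*2%:R / 2 ^+ k.+1 = j./2%:R / 2 ^+ k :> R by exact: IH.
by rewrite exprS -addnn natrD; field.
Qed.

Theorem Loewner_Heinz A B a : posdef A -> posdef B -> positive (A - B) ->
  0 <= a <= 1 -> positive (A `^^ a - B `^^ a).
Proof.
move=> pA pB AB /andP[a0 a1]; apply: positive_closed => e e0.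
have e20 : 0 < e / 2 by lra.
have [d1 d10 h1] := op_power_continuous a pA e20.
have [d2 d20 h2] := op_power_continuous a pB e20.
have [k [j [jk hj]]] : exists k j, (j <= 2 ^ k)%N /\
    `|j%:R / 2 ^+ k - a| <= Num.min d1 d2.
  pose d := Num.min d1 d2; have d0 : 0 < d by rewrite lt_min d10.
  (* Here 2^k > k and k exceeds 1/d, so the mesh 2^-k is below d; j is the integer part of a 2^k. *)
  pose k := Num.bound d^-1; exists k, (Num.truncn (a * 2 ^+ k)).
  have p0 : 0 < 2 ^+ k :> R by rewrite exprn_gt0.
  have ak : 0 <= a * 2 ^+ k by rewrite mulr_ge0// ltW.
  have /andP[t1 t2] := truncn_itv ak.
  split.
    rewrite -(ler_nat R) natrX; apply: le_trans t1 _.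
    by rewrite ler_piMl// ltW.
  have -> : forall n : nat, n%:R / 2 ^+ k - a = (n%:R - a * 2 ^+ k) / 2 ^+ k.
    by move=> n; field; rewrite gt_eqF.
  rewrite normrM [`|_^-1|]gtr0_norm ?invr_gt0// ler_pdivrMr//.
  rewrite distrC ger0_norm ?subr_ge0//.
  apply: le_trans (_ : 1 <= _); first by rewrite lerBlDr addrC natr1 ltW.
  rewrite mulrC -ler_pdivrMr// div1r; apply: ltW.
  apply: lt_trans (archi_boundP _) _; first by rewrite invr_ge0 ltW.
  by rewrite -natrX ltr_nat ltn_expl.
exists (A `^^ (j%:R / 2 ^+ k) - B `^^ (j%:R / 2 ^+ k)).
  exact: power_dyadic.
move: hj; rewrite le_min => /andP[/h1 H1 /h2 H2].
have -> (X X' Y Y' : operator H) : X - Y - (X' - Y') = (X - X') + - (Y - Y').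
  by rewrite !opprB [Y' - X']addrC addrACA [- Y + _]addrC.
apply: le_trans (opnormD _ _) _; rewrite opnormN.
by apply: le_trans (lerD H1 H2) _; rewrite -splitr.
Qed.

End Monotonicity.

(** * The Furuta inequality *)

Section Furuta.
Local Notation "X `^^ a" := (opow X a) : ring_scope.
Context {R : realType} {H : hilbertType R}.
Implicit Types (x y z : H) (a b c d e h k p r t s : R)
  (S T X Y Z C D G A B : operator H).

(** The product X Y intertwines M = X Y^2 X and N = Y X^2 Y, hence also their powers: M^a X Y = X Y
    N^(a-1) N. As N = Y X X Y, the factor X Y cancels on the right. *)
Lemma power_conj X Y a : posdef X -> posdef Y ->
  (X * (Y * Y) * X) `^^ a = X * Y * (Y * (X * X) * Y) `^^ (a - 1) * Y * X.
Proof.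
move=> pX pY; set M := X * (Y * Y) * X; set N := Y * (X * X) * Y.
have pM : posdef M.
  rewrite /M -(mulr1 (Y * Y)) -mulrA mulrA; apply: posdef_conj => //.
  have p1 : posdef (1 : operator H).
    by have := posdef_power 0 pY; rewrite op_power0.
  by have := posdef_conj pY p1; rewrite !mulr1.
have pN : posdef N.
  rewrite /N; apply: posdef_conj => //.
  have p1 : posdef (1 : operator H).
    by have := posdef_power 0 pX; rewrite op_power0.
  by have := posdef_conj pX p1; rewrite mulr1.
have sw : M * (X * Y) = (X * Y) * N by rewrite /M /N !mulrA.
have h := op_power_swap a pM pN sw.
have NE : N = Y * X * (X * Y) by rewrite /N !mulrA.
have Na : N `^^ a = N `^^ (a - 1) * N.
  by have := op_powerD (a - 1) 1 pN; rewrite subrK (op_power1 pN).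
have iX := op_powerVN 1 pX; have iY := op_powerVN 1 pY.
rewrite (op_power1 pX) in iX; rewrite (op_power1 pY) in iY.
move: h; rewrite Na {2}NE; move: (M `^^ a) (N `^^ (a - 1)) => P Q h.
move: (X `^^ (-1)) (Y `^^ (-1)) iX iY => X' Y' iX iY.
have := congr1 (fun Z => Z * Y' * X') h.
by rewrite !mulrA -[P * X * Y * Y']mulrA iY mulr1 -[P * X * X']mulrA iX mulr1
  -[_ * X * Y * Y']mulrA iY mulr1 -[_ * X * X']mulrA iX mulr1.
Qed.

(** By [power_conj] the power becomes X Y N^(-u) Y X, where N = Y A^r Y >= B^(p+r) by Loewner-Heinz
    (r <= 1) and u = (p-1)/(p+r) lies in [0, 1]. Thus N^(-u) <= B^(1-p), and the whole is at most X
    B X <= X A X = A^(1+r). *)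
Lemma Furuta_le1 A B p r : posdef A -> posdef B -> positive (A - B) ->
  1 <= p -> 0 <= r <= 1 ->
  positive (A `^^ (1 + r) -
    (A `^^ (r / 2) * B `^^ p * A `^^ (r / 2)) `^^ ((1 + r) / (p + r))).
Proof.
move=> pA pB AB p1 /andP[r0 r1].
pose X := A `^^ (r / 2); pose Y := B `^^ (p / 2).
have pX : posdef X by exact: posdef_power.
have pY : posdef Y by exact: posdef_power.
have XX : X * X = A `^^ r by rewrite [r in RHS]splitr (op_powerD _ _ pA).
have YY : Y * Y = B `^^ p by rewrite [p in RHS]splitr (op_powerD _ _ pB).
have XAX : X * A * X = A `^^ (1 + r).
  transitivity (X * A `^^ 1 * X); first by rewrite (op_power1 pA).
  by rewrite /X -!(op_powerD _ _ pA); congr (_ `^^ _); lra.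
have YBY : Y * B `^^ r * Y = B `^^ (p + r).
  by rewrite /Y -!(op_powerD _ _ pB); congr (_ `^^ _); lra.
have YBY1 : Y * B `^^ (1 - p) * Y = B.
  rewrite -[RHS](op_power1 pB) /Y -!(op_powerD _ _ pB); congr (_ `^^ _); lra.
rewrite -/X -YY (power_conj _ pX pY) XX; clearbody X Y.
have pr : 0 < p + r by lra.
pose u := (p - 1) / (p + r).
have u01 : 0 <= u <= 1.
  by rewrite /u divr_ge0 ?subr_ge0 ?(ltW pr)//= ler_pdivrMr// mul1r; lra.
have -> : (1 + r) / (p + r) - 1 = u * (-1) by rewrite /u; field; rewrite gt_eqF.
pose N := Y * A `^^ r * Y; rewrite -/N.
have pN : posdef N by exact: posdef_conj pY (posdef_power r pA).
have NB : positive (N - B `^^ (p + r)).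
  rewrite -YBY; apply: (ge_conj (posdef_selfadjoint pY)).
  by apply: (Loewner_Heinz pA pB AB); rewrite r0.
clearbody N; have pBpr : posdef (B `^^ (p + r)) by exact: posdef_power.
have NuB := Loewner_Heinz pN pBpr NB u01.
have := inverse_antitone (posdef_power u pN) (posdef_power u pBpr) NuB.
rewrite (op_powerM _ _ pN) (op_powerM _ _ pB) (op_powerM _ _ pB).
have -> : (p + r) * u * -1 = 1 - p by rewrite /u; field; rewrite gt_eqF.
move=> /(ge_conj (posdef_selfadjoint pY)); rewrite YBY1.
move=> /(ge_conj (posdef_selfadjoint pX)).
have AX := ge_conj (posdef_selfadjoint pX) AB; rewrite XAX in AX.
by rewrite !mulrA => YX; exact: (positive_trans AX YX).
Qed.

Theorem Furuta A B p r : posdef A -> posdef B -> positive (A - B) ->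
  1 <= p -> 0 <= r ->
  positive (A `^^ (1 + r) -
    (A `^^ (r / 2) * B `^^ p * A `^^ (r / 2)) `^^ ((1 + r) / (p + r))).
Proof.
move=> pA pB AB p1 r0.
have [n rn] : exists n : nat, r <= n%:R.
  by exists (Num.bound r); apply/ltW/archi_boundP.
elim: n r r0 rn => [|n IH] r r0 rn.
  by apply: (Furuta_le1 pA pB AB p1); rewrite r0 (le_trans rn).
have [r1|r1] := leP r 1; first by apply: (Furuta_le1 pA pB AB p1); rewrite r0.
(* The case r = 1 is applied to A^(1+q) and Z^((1+q)/(p+q)), which are ordered by induction; it
   raises the exponent q to 1 + 2q = r. *)
pose q := (r - 1) / 2.
have q0 : 0 <= q by rewrite /q; lra.
have qn : q <= n%:R by move: rn; rewrite -natr1 /q; lra.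
have h := IH q q0 qn.
pose Z := A `^^ (q / 2) * B `^^ p * A `^^ (q / 2).
have pZ : posdef Z by exact: posdef_conj (posdef_power _ pA) (posdef_power _ pB).
have pq : 0 < p + q by lra.
have q1 : 0 < 1 + q by lra.
have p'1 : 1 <= (p + q) / (1 + q) by rewrite ler_pdivlMr// mul1r; lra.
have := Furuta_le1 (posdef_power _ pA) (posdef_power _ pZ) h p'1
  (_ : 0 <= 1 <= 1).
rewrite ler01 lexx => /(_ isT).
rewrite !(op_powerM _ _ pA) (op_powerM _ _ pZ).
have -> : (1 + q) / (p + q) * ((p + q) / (1 + q)) = 1.
  by field; rewrite !gt_eqF.
rewrite (op_power1 pZ).
have -> : (1 + q) * (1 + 1) = 1 + r by rewrite /q; field.
have -> : (1 + 1) / ((p + q) / (1 + q) + 1) = (1 + r) / (p + r).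
  rewrite /q; field; rewrite !gt_eqF//; lra.
have -> : A `^^ ((1 + q) * (1 / 2)) * Z * A `^^ ((1 + q) * (1 / 2)) =
    A `^^ (r / 2) * B `^^ p * A `^^ (r / 2).
  rewrite /Z !mulrA -(op_powerD _ _ pA) -[LHS]mulrA -(op_powerD _ _ pA).
  by congr (_ `^^ _ * _ * _ `^^ _); rewrite /q; field.
exact.
Qed.

End Furuta.

(** * Logarithms *)

Section Logarithm.
Local Notation "X `^^ a" := (opow X a) : ring_scope.
Context {R : realType} {H : hilbertType R}.
Implicit Types (x y z : H) (a b c d e h k p r t s : R)
  (S T X Y Z C D G A B K L : operator H).

Lemma is_op_logP T L : is_op_log T L <-> forall e, 0 < e -> exists2 d, 0 < d &
  forall h, 0 < h <= d -> opnorm (h^-1%:C *: (T `^^ h - 1) - L) <= e.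
Proof.
rewrite /is_op_log opow.unlock; split=> [/cvgrPdist_le cv e e0|cv].
  have [d /= d0 dP] := cv _ e0.
  exists (d / 2) => [|h /andP[h0 hd]]; first lra.
  have hd2 : `|0 - h| < d by rewrite sub0r normrN gtr0_norm//; lra.
  by have := dP h hd2 h0; rewrite sub0r normrN ger0_norm// opnorm_ge0.
apply/cvgrPdist_le => e e0; have [d d0 dP] := cv _ e0.
exists d => // h /=; rewrite sub0r normrN => hd h0.
rewrite sub0r normrN ger0_norm ?opnorm_ge0//; apply: dP.
by rewrite h0 -(gtr0_norm h0) ltW.
Qed.

Lemma is_op_log_cfc T : posdef T -> is_op_log T (cfc (@ln R) T).
Proof.
move=> pT; apply/is_op_logP => e e0.
have [d d0 [C C0 dC]] := op_power_log_expansion pT.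
have C1 : 0 < C + 1 by lra.
exists (Num.min d (e / (C + 1))); first by rewrite lt_min d0 divr_gt0.
move=> h; rewrite le_min => /andP[h0 /andP[hd he]].
have -> : h^-1%:C *: (T `^^ h - 1) - cfc (@ln R) T =
    h^-1%:C *: (T `^^ h - 1 - h%:C *: cfc (@ln R) T).
  by rewrite [RHS]scalerBr scalerA -rmorphM/= mulVf ?gt_eqF// scale1r.
apply: le_trans (opnormZ_le _ _) _.
rewrite gtr0_norm ?invr_gt0// ler_pdivrMl//.
have hd' : `|h| <= d by rewrite gtr0_norm.
apply: le_trans (dC h hd') _; move: he; rewrite ler_pdivlMr// => he.
nra.
Qed.

Lemma op_logE T : posdef T -> op_log T = cfc (@ln R) T.
Proof.
move=> pT; have lT := is_op_log_cfc pT.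
have : is_op_log T (op_log T) by apply: xgetPex; exists (cfc (@ln R) T).
move: lT; move: (op_log T) (cfc _ T) => L L' /is_op_logP lL' /is_op_logP lL.
apply: opnorm_eq => e e0; have e20 : 0 < e / 2 by lra.
have [d d0 dP] := lL _ e20; have [d' d'0 d'P] := lL' _ e20.
pose h := Num.min d d'; have h0 : 0 < h by rewrite lt_min d0.
apply: le_trans (opnorm_triangle _ _ (h^-1%:C *: (T `^^ h - 1))) _.
rewrite opnormB.
apply: le_trans (lerD (dP h _) (d'P h _)) _; rewrite -?splitr//.
  by rewrite h0 ge_min lexx.
by rewrite h0 ge_min lexx orbT.
Qed.

Lemma selfadjoint_cfc_ln T : posdef T -> selfadjoint (cfc (@ln R) T).
Proof.
move=> /posdefP[m [M [m0 mM bT]]].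
have al := ln_approximable M m0; have [N N0 lN] := approximable_bounded al.
apply: (@bounds_selfadjoint _ _ (- N) N); apply: (cfc_bounds bT al) => c /lN.
by rewrite ler_norml.
Qed.

Lemma chaotic_geP A B : posdef A -> posdef B ->
  chaotic_ge A B <-> positive (cfc (@ln R) A - cfc (@ln R) B).
Proof.
move=> pA pB; rewrite /chaotic_ge !op_logE//.
by split=> [[]//|h]; split=> //; exact: selfadjoint_cfc_ln.
Qed.

(** Says F(h) = 1 + h K + O(h^2) as h decreases to 0. The explicit quadratic remainder lets products
    be expanded by norm estimates alone. *)
Definition first_order (F : R -> operator H) K := exists2 d, 0 < d &
  exists2 C : R, 0 <= C & forall h, 0 < h <= d ->
    opnorm (F h - 1 - h%:C *: K) <= C * h ^+ 2.

Lemma first_order_unique F K L : first_order F K -> first_order F L -> K = L.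
Proof.
move=> [d d0 [C C0 dC]] [d' d'0 [C' C'0 d'C]]; apply: opnorm_eq => e e0.
have CC : 0 < C + C' + 1 by lra.
pose h := Num.min (Num.min d d') (e / (C + C' + 1)).
have h0 : 0 < h by rewrite !lt_min d0 d'0 divr_gt0.
have hd : 0 < h <= d by rewrite h0 !ge_min lexx.
have hd' : 0 < h <= d' by rewrite h0 !ge_min lexx orbT.
have he : h * (C + C' + 1) <= e.
  by rewrite -ler_pdivlMr// ge_min lexx orbT.
have hn : h != 0 by rewrite gt_eqF.
have -> : K - L = h^-1%:C *: ((F h - 1 - h%:C *: L) - (F h - 1 - h%:C *: K)).
  have -> X : (X - h%:C *: L) - (X - h%:C *: K) = h%:C *: (K - L).
    by rewrite opprB addrC addrA subrK scalerBr.
  by rewrite scalerA -rmorphM/= mulVf// scale1r.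
apply: le_trans (opnormZ_le _ _) _.
rewrite gtr0_norm ?invr_gt0// ler_pdivrMl//.
apply: le_trans (opnormD _ _) _; rewrite opnormN.
apply: le_trans (lerD (d'C h hd') (dC h hd)) _.
nra.
Qed.

Lemma first_order_power T a : posdef T ->
  first_order (fun h => T `^^ (a * h)) (a%:C *: cfc (@ln R) T).
Proof.
move=> pT; have [d d0 [C C0 dC]] := op_power_log_expansion pT.
have a1 : 0 < `|a| + 1 by rewrite ltr_wpDl.
exists (d / (`|a| + 1)); first by rewrite divr_gt0.
exists (C * a ^+ 2); first by rewrite mulr_ge0// sqr_ge0.
move=> h /andP[h0]; rewrite ler_pdivlMr// => hd.
have ah : `|a * h| <= d.
  by rewrite normrM (gtr0_norm h0); have := normr_ge0 a; nra.
have := dC _ ah; rewrite exprMn mulrA scalerA -rmorphM/= [h * a]mulrC.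
exact.
Qed.

(** Both sides are first-order coefficients of h |-> T^(-h). *)
Lemma cfc_ln_inverse T : posdef T ->
  cfc (@ln R) (T `^^ (-1)) = - cfc (@ln R) T.
Proof.
move=> pT; have := first_order_power (-1) pT; rewrite rmorphN1 scaleN1r.
apply: first_order_unique.
have := first_order_power 1 (posdef_power (-1) pT); rewrite rmorph1 scale1r.
congr (first_order _ _); apply/funext => h.
by rewrite (op_powerM _ _ pT) mul1r.
Qed.

Lemma first_orderM (F G : R -> operator H) K L :
  first_order F K -> first_order G L ->
  first_order (fun h => F h * G h) (K + L).
Proof.
move=> [d d0 [C C0 dC]] [d' d'0 [C' C'0 d'C]].
(* For h <= 1, [g] bounds the norm of G h and [k] that of 1 + h K, the two cofactors in the product
   rule below. *)
pose g := 1 + opnorm L + C'; pose k := 1 + opnorm K.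
exists (Num.min 1 (Num.min d d')); first by rewrite !lt_min ltr01 d0.
have K0 := opnorm_ge0 K; have L0 := opnorm_ge0 L.
have n1 : opnorm (1 : operator H) <= 1.
  by apply: opnorm_le => // x; rewrite mul1r.
exists (C * g + k * C' + opnorm K * opnorm L) => [|h].
  by rewrite !addr_ge0 ?mulr_ge0 /g /k ?addr_ge0.
rewrite !le_min => /and3P[h0 h1 /andP[hd hd']].
have {}dC := dC h (introT andP (conj h0 hd)).
have {}d'C := d'C h (introT andP (conj h0 hd')).
have -> : F h * G h - 1 - h%:C *: (K + L) =
    (F h - 1 - h%:C *: K) * G h + (1 + h%:C *: K) * (G h - 1 - h%:C *: L) +
    (h%:C *: K) * (h%:C *: L).
  rewrite -[F h - 1 - _]addrA -opprD mulrBl -[G h - 1 - _]addrA -opprD mulrBr.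
  rewrite addrA subrK [(1 + h%:C *: K) * (1 + _)]mulrDl mul1r mulrDr mulr1.
  by rewrite scalerDr !opprD !addrA subrK addrAC.
have hh : `|h| = h by rewrite gtr0_norm.
have hK : opnorm (h%:C *: K) <= h * opnorm K by rewrite -{2}hh opnormZ_le.
have hL : opnorm (h%:C *: L) <= h * opnorm L by rewrite -{2}hh opnormZ_le.
have Gg : opnorm (G h) <= g.
  have -> : G h = (G h - 1 - h%:C *: L) + h%:C *: L + 1 by rewrite !subrK.
  apply: le_trans (opnormD _ _) _.
  apply: le_trans (lerD (opnormD _ _) n1) _.
  apply: le_trans (lerD (lerD d'C hL) (lexx _)) _.
  have h2 : h ^+ 2 <= 1 by rewrite expr_le1// ltW.
  have := ler_wpM2l C'0 h2; have := ler_wpM2r L0 h1.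
  by rewrite /g; move: (opnorm L) {dC d'C hK hL n1 K0 L0} => l; lra.
have Kk : opnorm (1 + h%:C *: K) <= k.
  apply: le_trans (opnormD _ _) _; apply: le_trans (lerD n1 hK) _.
  have := ler_wpM2r K0 h1.
  by rewrite /k; move: (opnorm K) {dC d'C hK hL n1 L0 K0 Gg} => l; lra.
apply: le_trans (opnormD _ _) _.
apply: le_trans (lerD (opnormD _ _) (opnormM _ _)) _.
apply: le_trans (lerD (lerD (opnormM _ _) (opnormM _ _)) (lexx _)) _.
have o0 := @opnorm_ge0 R H.
have e1 := ler_pM (o0 _) (o0 _) dC Gg; have e2 := ler_pM (o0 _) (o0 _) Kk d'C.
have e3 := ler_pM (o0 _) (o0 _) hK hL.
apply: le_trans (lerD (lerD e1 e2) e3) _.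
by rewrite le_eqVlt; apply/orP; left; apply/eqP; ring.
Qed.

End Logarithm.

(** * The Furuta inequality under the chaotic order *)

Section ChaoticFuruta.
Local Notation "X `^^ a" := (opow X a) : ring_scope.
Context {R : realType} {H : hilbertType R}.
Implicit Types (x y z : H) (a b c d e h k p r t s : R)
  (S T X Y Z C D G A B K L : operator H).

Lemma positive_sub_ip S T x : positive (S - T) -> ip (T x) x <= ip (S x) x.
Proof. by move=> /(positive_ip x); rewrite /= ipBl subr_ge0. Qed.

Lemma positive_Zsub c S T : selfadjoint S -> selfadjoint T ->
  (forall x, ip (T x) x <= c * ip (S x) x) -> positive (c%:C *: S - T).
Proof.
move=> sS sT h; apply/positiveP; split=> [|x].
  by apply: selfadjointB => //; exact: selfadjointZ.
by rewrite /= !ipE subr_ge0.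
Qed.

Lemma opnorm_expansion_ip S T c e x : opnorm (S - 1 - c%:C *: T) <= e ->
  `|ip (S x) x - ip x x - c * ip (T x) x| <= e * ip x x.
Proof.
move=> Se; have := ip_opnorm (S - 1 - c%:C *: T) x; rewrite /= !ipE => h.
by apply: le_trans h _; rewrite ler_wpM2r ?ip_ge0.
Qed.

Lemma posdefZ A k : posdef A -> 0 < k -> posdef (k%:C *: A).
Proof.
move=> [pA [S [SA AS]]] k0; split; first exact: positiveZ (ltW k0) pA.
exists (k^-1%:C *: S).
by split; rewrite opscaleAl opscaleAr scalerA -rmorphM/= ?mulVf ?divff ?gt_eqF//
  scale1r.
Qed.

Lemma op_powerZ A k a : posdef A -> 0 < k ->
  (k%:C *: A) `^^ a = (k `^ a)%:C *: A `^^ a.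
Proof.
move=> /posdefP[m [M [m0 mM bT]]] k0; rewrite !opowE.
have aid := approximable_id m M.
have ap := powR_approximable M a m0.
rewrite -{1}(cfc_id bT) -(cfcZ bT k aid) -(cfcZ bT _ ap).
have kab c : m <= c <= M -> k `^ a * c `^ a = (k * c) `^ a.
  by move=> /andP[mc _]; rewrite powRM ?(ltW k0)// (le_trans (ltW m0)).
have ac : polynomially_approximable m M
    ((fun c => c `^ a) \o (fun c => k * id c)).
  move=> e e0; have [q qf] := approximableZ (k `^ a) ap e0; exists q => c cm.
  by rewrite /= -kab//; exact: qf.
have km0 : 0 < k * m by rewrite mulr_gt0.
rewrite (cfc_comp bT (approximableZ k aid) _
  (powR_approximable (k * M) a km0) ac).
  by apply: (eq_cfc bT) => // c cm; rewrite /= kab.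
by move=> c /andP[mc cM]; rewrite !ler_pM2l// mc.
Qed.

(** The scalars are the quadratic forms of A^h, B^h, log A, log B and 1 at one vector. The margin e
    h n coming from (1 + e h) a outweighs the errors of size h^2 n as soon as h (CA + CB + e l + e
    CA) <= e. *)
Lemma small_power_bound (e h CA CB l la lb a b n : R) : 0 <= e -> 0 <= h ->
  0 <= CA -> h <= 1 -> h * (CA + CB + e * l + e * CA + 1) <= e ->
  lb <= la -> 0 <= a -> 0 <= n -> `|la| <= l * n ->
  `|a - n - h * la| <= CA * h ^+ 2 * n ->
  `|b - n - h * lb| <= CB * h ^+ 2 * n ->
  b <= expR (e * h) * a.
Proof.
move=> e0 h0 CA0 h1 hQ lab a0 n0.
rewrite !ler_norml => /andP[la1 la2] /andP[a1 a2] /andP[b1 b2].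
have Ea : (1 + e * h) * a <= expR (e * h) * a by rewrite ler_wpM2r ?expR_ge1Dx.
have hlab : 0 <= h * (la - lb) by rewrite mulr_ge0 ?subr_ge0.
have hQn := ler_wpM2l (mulr_ge0 h0 n0) hQ.
have hla : h * (- (l * n)) <= h * la by rewrite ler_wpM2l.
have ea : e * h * (n + h * la - CA * h ^+ 2 * n) <= e * h * a.
  by rewrite ler_wpM2l ?mulr_ge0//; lra.
have ehla : e * h * (h * (- (l * n))) <= e * h * (h * la).
  by rewrite ler_wpM2l ?mulr_ge0.
have h3 : e * CA * n * (h ^+ 2 * h) <= e * CA * n * (h ^+ 2 * 1).
  by rewrite ler_wpM2l ?mulr_ge0// ler_wpM2l ?sqr_ge0.
have h4 : 0 <= h ^+ 2 * n by rewrite mulr_ge0 ?sqr_ge0.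
apply: le_trans Ea; lra.
Qed.

Lemma chaotic_small_powers A B e : posdef A -> posdef B ->
  positive (cfc (@ln R) A - cfc (@ln R) B) -> 0 < e ->
  exists2 d, 0 < d & forall h, 0 < h <= d ->
    positive ((expR (e * h))%:C *: A `^^ h - B `^^ h).
Proof.
move=> pA pB AB e0.
have [dA dA0 [CA CA0 dCA]] := op_power_log_expansion pA.
have [dB dB0 [CB CB0 dCB]] := op_power_log_expansion pB.
set LA := cfc _ A in AB dCA; set LB := cfc _ B in AB dCB.
pose l := opnorm LA; have l0 : 0 <= l by exact: opnorm_ge0.
pose Q := CA + CB + e * l + e * CA + 1.
have Q0 : 0 < Q by rewrite ltr_wpDl// !addr_ge0 ?mulr_ge0 ?(ltW e0).
exists (Num.min 1 (Num.min (e / Q) (Num.min dA dB))).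
  by rewrite !lt_min ltr01 divr_gt0// dA0.
move=> h; rewrite !le_min => /andP[h0 /and4P[h1 hQ hA hB]].
have hh : `|h| = h by rewrite gtr0_norm.
have pAh := posdef_power h pA; have pBh := posdef_power h pB.
apply: positive_Zsub; [exact: power_selfadjoint|exact: power_selfadjoint|].
move=> x.
have hAx := opnorm_expansion_ip x (dCA h (eq_ind_r (fun u => u <= dA) hA hh)).
have hBx := opnorm_expansion_ip x (dCB h (eq_ind_r (fun u => u <= dB) hB hh)).
have ABx := positive_sub_ip x AB; have lx := ip_opnorm LA x.
have Ax0 := positive_ip x (proj1 pAh); have x0 := ip_ge0 x.
move: hQ; rewrite ler_pdivlMr// => hQ.
exact: small_power_bound (ltW e0) (ltW h0) CA0 h1 hQ ABx Ax0 x0 lx hAx hBx.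
Qed.

Theorem chaotic_Furuta A B p r : posdef A -> posdef B ->
  positive (cfc (@ln R) A - cfc (@ln R) B) -> 0 < p -> 0 < r ->
  positive (A `^^ r -
    (A `^^ (r / 2) * B `^^ p * A `^^ (r / 2)) `^^ (r / (p + r))).
Proof.
move=> pA pB AB p0 r0.
pose W := A `^^ (r / 2) * B `^^ p * A `^^ (r / 2).
have pW : posdef W by exact: posdef_conj (posdef_power _ pA) (posdef_power _ pB).
have pr : 0 < p + r by lra.
(* Replacing A by exp(e) A scales A^r by exp(e r) and the other side by exp(e r) to the power r / (p
   + r); the quotient of the two factors is exp(e q). *)
pose q := p / (p + r) * r.
have q0 : 0 < q by rewrite mulr_gt0 ?divr_gt0.
have strict e : 0 < e ->
    positive ((expR (e * q))%:C *: A `^^ r - W `^^ (r / (p + r))).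
  move=> e0; have [d d0 dP] := chaotic_small_powers pA pB AB e0.
  (* The bound h <= p is what makes the exponent p / h of the Furuta inequality at least 1. *)
  pose h := Num.min d p; have h0 : 0 < h by rewrite lt_min d0.
  have hd : 0 < h <= d by rewrite h0 ge_min lexx.
  have hp : h <= p by rewrite ge_min lexx orbT.
  pose A' := (expR e)%:C *: A.
  have pA' : posdef A' by exact: posdefZ (expR_gt0 e).
  have A'E a : A' `^^ a = (expR (e * a))%:C *: A `^^ a.
    by rewrite /A' op_powerZ ?expR_gt0// /powR gt_eqF ?expR_gt0// expRK mulrC.
  have A'B : positive (A' `^^ h - B `^^ h) by rewrite A'E; exact: dP.
  have p1 : 1 <= p / h by rewrite ler_pdivlMr// mul1r.
  have rh : 0 <= r / h by rewrite divr_ge0 ?ltW.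
  have := Furuta (posdef_power _ pA') (posdef_power _ pB) A'B p1 rh.
  rewrite !(op_powerM _ _ pA') (op_powerM _ _ pB).
  have -> : h * (1 + r / h) = h + r by field; rewrite gt_eqF.
  have -> : h * (r / h / 2) = r / 2 by field; rewrite gt_eqF.
  have -> : h * (p / h) = p by field; rewrite gt_eqF.
  have -> : (1 + r / h) / (p / h + r / h) = (h + r) / (p + r).
    by field; rewrite !gt_eqF.
  pose W' := A' `^^ (r / 2) * B `^^ p * A' `^^ (r / 2); rewrite -/W' => F.
  have pW' : posdef W'.
    exact: posdef_conj (posdef_power _ pA') (posdef_power _ pB).
  have hr : 0 < h + r by lra.
  have hr1 : 0 <= r / (h + r) <= 1.
    by rewrite divr_ge0 ?(ltW r0) ?(ltW hr)//= ler_pdivrMr// mul1r lerDr ltW.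
  have := Loewner_Heinz (posdef_power _ pA') (posdef_power _ pW') F hr1.
  rewrite (op_powerM _ _ pA') (op_powerM _ _ pW').
  have -> : (h + r) * (r / (h + r)) = r by field; rewrite gt_eqF.
  have -> : (h + r) / (p + r) * (r / (h + r)) = r / (p + r).
    by field; rewrite !gt_eqF.
  have W'E : W' = (expR (e * r))%:C *: W.
    rewrite /W' !A'E !opscaleAl opscaleAr scalerA -rmorphM/= -expRD.
    by rewrite -mulrDr -splitr.
  rewrite W'E (op_powerZ _ pW (expR_gt0 _)) A'E.
  have -> : expR (e * r) `^ (r / (p + r)) = expR (e * r * (r / (p + r))).
    by rewrite /powR gt_eqF ?expR_gt0// expRK mulrC.
  move=> /(positiveZ (expR_ge0 (- (e * r * (r / (p + r)))))).
  rewrite scalerBr !scalerA -!rmorphM/= -!expRD addNr expR0 scale1r.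
  have -> : - (e * r * (r / (p + r))) + e * r = e * q.
    by rewrite /q; field; rewrite gt_eqF.
  exact.
rewrite -/W; apply: positive_closed => e e0.
pose N := opnorm (A `^^ r); have N0 : 0 <= N by exact: opnorm_ge0.
(* This is the value given to e q. For u <= 1/2, exp(u) - 1 <= 2 u, so the scaled operator is within
   2 u N of A^r. *)
pose u := Num.min 2^-1 (e / (2 * (N + 1))).
have N1 : 0 < 2 * (N + 1) by lra.
have u0 : 0 < u by rewrite lt_min invr_gt0 ltr0n divr_gt0.
have uN : u * (2 * (N + 1)) <= e by rewrite -ler_pdivlMr// ge_min lexx orbT.
exists ((expR (u / q * q))%:C *: A `^^ r - W `^^ (r / (p + r))).
  exact: strict (divr_gt0 u0 q0).
rewrite divfK ?gt_eqF// opprB addrA subrK -[X in _ - X]scale1r.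
rewrite -(rmorph1 (real_complex R)) -scalerBl -rmorphB/=.
apply: le_trans (opnormZ_le _ _) _; rewrite -/N.
have u2 : u <= 2^-1 by rewrite ge_min lexx.
have := expR_taylor2 u2; rewrite ler_norml => /andP[_ h2].
rewrite ger0_norm; last by have := expR_ge1Dx u; lra.
have h3 : expR u - 1 <= 2 * u by nra.
by have := ler_wpM2r N0 h3; nra.
Qed.

End ChaoticFuruta.

(** * The equivalences *)

Section Characterizations.
Local Notation "X `^^ a" := (opow X a) : ring_scope.
Context {R : realType} {H : hilbertType R}.
Implicit Types (x y z : H) (a b c d e h k p r t s : R)
  (S T X Y Z C D G A B K L Q V W : operator H).
Implicit Types n : nat.

Definition furuta_mean n p r t s A B : operator H :=
  (A `^^ (r / 2) * (A `^^ (t / 2) * B `^^ p * A `^^ (t / 2)) `^^ s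
     * A `^^ (r / 2)) `^^ (n.+1%:R^-1).

Definition grand_furuta n A B := forall p r t s : R, exponents n p r t s ->
  positive (A `^^ (t + r) - furuta_mean n p r t s A B).

Lemma posdef_inner_power A B t p : posdef A -> posdef B ->
  posdef (A `^^ (t / 2) * B `^^ p * A `^^ (t / 2)).
Proof.
by move=> pA pB; exact: posdef_conj (posdef_power _ pA) (posdef_power _ pB).
Qed.

Lemma posdef_outer_power A B p r t s : posdef A -> posdef B ->
  posdef (A `^^ (r / 2) * (A `^^ (t / 2) * B `^^ p * A `^^ (t / 2)) `^^ s
     * A `^^ (r / 2)).
Proof.
move=> pA pB; exact: posdef_conj (posdef_power _ pA)
  (posdef_power _ (posdef_inner_power t p pA pB)).
Qed.

(** The relation reads (p + t) s = n (t + r) + t, positive since n >= 1. *)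
Lemma exponents_s_gt0 n p r t s : (1 <= n)%N -> exponents n p r t s -> 0 < s.
Proof.
move=> n1 [p0 r0 t0 e].
have n1' : 1 <= n%:R :> R by rewrite ler1n.
have pt : 0 < p + t by lra.
rewrite -(pmulr_rgt0 _ pt).
move: e; rewrite -natr1 => e; nra.
Qed.

Lemma chaotic_grand_furuta n A B : (1 <= n)%N -> posdef A -> posdef B ->
  positive (cfc (@ln R) A - cfc (@ln R) B) -> grand_furuta n A B.
Proof.
move=> n1 pA pB AB p r t s ex; have s0 := exponents_s_gt0 n1 ex.
have n1' : 1 <= n%:R :> R by rewrite ler1n.
have n0 : 0 < n.+1%:R :> R by rewrite ltr0n.
case: ex => p0 r0 t0; rewrite /furuta_mean.
(* The second use of the Furuta inequality has exponents divided by t; for t = 0 the first one, with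
   p s in place of p, is already the claim. *)
have [->|tn] := eqVneq t 0.
  rewrite mul0r (op_power0 pA) mul1r mulr1 !add0r addr0 (op_powerM _ _ pB) => e.
  have := chaotic_Furuta pA pB AB (mulr_gt0 p0 s0) r0.
  suff -> : r / (p * s + r) = n.+1%:R^-1 by exact.
  by rewrite e; field; rewrite !gt_eqF.
have {t0}tp : 0 < t by rewrite lt_neqAle eq_sym tn.
move=> e; pose Q := A `^^ (t / 2) * B `^^ p * A `^^ (t / 2).
have pQ : posdef Q by exact: posdef_inner_power.
have pt : 0 < p + t by lra.
have AQ := chaotic_Furuta pA pB AB p0 tp; rewrite -/Q in AQ *.
clearbody Q.
(* Since (p + t) s = n (t + r) + t, the exponent (p + t) s / t is at least 1. *)
have pts : t <= (p + t) * s by move: e; rewrite -natr1; nra.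
have p1 : 1 <= (p + t) * s / t by rewrite ler_pdivlMr// mul1r.
have rt : 0 <= r / t by rewrite divr_ge0 ?ltW.
have := Furuta (posdef_power _ pA) (posdef_power _ pQ) AQ p1 rt.
rewrite !(op_powerM _ _ pA) (op_powerM _ _ pQ).
have -> : t * (1 + r / t) = t + r by field; rewrite gt_eqF.
have -> : t * (r / t / 2) = r / 2 by field; rewrite gt_eqF.
have -> : t / (p + t) * ((p + t) * s / t) = s by field; rewrite !gt_eqF.
suff -> : (1 + r / t) / ((p + t) * s / t + r / t) = n.+1%:R^-1 by exact.
have -> : (1 + r / t) / ((p + t) * s / t + r / t) = (t + r) / ((p + t) * s + r).
  field; rewrite !gt_eqF//; nra.
by rewrite e; field; rewrite !gt_eqF//; lra.
Qed.

(** With N = n + 1, both N (c^(1/N) - 1) >= ln c and ln c >= 1 - 1/c are instances of exp(x) >= 1 +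
    x; adding them eliminates the logarithm. *)
Lemma power_bernoulli n Z : posdef Z ->
  positive (n.+1%:R%:C *: Z `^^ (n.+1%:R^-1) - n.+1%:R%:O - 1 + Z `^^ (-1)).
Proof.
move=> /posdefP[m [M [m0 mM bT]]]; set N := n.+1%:R : R.
have N0 : 0 < N by rewrite ltr0n.
have a1 := powR_approximable M N^-1 m0; have a2 := powR_approximable M (-1) m0.
have a3 := approximable_cst m M (- N - 1).
have -> : N%:C *: Z `^^ (N^-1) - N%:O - 1 + Z `^^ (-1) =
    cfc (fun c => N * c `^ (N^-1) + (- N - 1) + c `^ (-1)) Z.
  have aZ := approximableZ N a1.
  rewrite (cfcD bT (approximableD aZ a3) a2) (cfcD bT aZ a3) (cfcZ bT _ a1).
  rewrite (cfc_cst bT) !opowE rmorphB rmorphN/= rmorph1 scalerBl scaleNr scale1r.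
  by rewrite addrA.
apply: (cfc_positive bT) => [|c /andP[mc _]].
  exact: approximableD (approximableD (approximableZ N a1) a3) a2.
have c0 : 0 < c by lra.
rewrite /powR !gt_eqF// mulN1r.
have h1 := expR_ge1Dx (N^-1 * ln c); have h2 := expR_ge1Dx (- ln c).
have := ler_wpM2l (ltW N0) h1; rewrite mulrDr mulr1 mulrA divff ?gt_eqF// mul1r.
lra.
Qed.

Lemma grand_furuta_chaotic n A B : (1 <= n)%N -> posdef A -> posdef B ->
  grand_furuta n A B -> positive (cfc (@ln R) A - cfc (@ln R) B).
Proof.
move=> n1 pA pB gf.
have n0 : 0 < n%:R :> R by rewrite ltr0n.
pose N : R := n.+1%:R; have N0 : 0 < N by rewrite ltr0n.
have NE : N = n%:R + 1 by rewrite natr1.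
(* The first-order coefficient in r of this positive operator is N log A - log A - n log B, that is
   n (log A - log B). *)
have main r : 0 < r -> positive (N%:C *: A `^^ (1 * r) - N%:O - 1 +
    A `^^ (- (1 / 2) * r) * B `^^ (- n%:R * r) * A `^^ (- (1 / 2) * r)).
  move=> r0.
  have ex : exponents n (n%:R * r) r 0 1.
    split=> //; first exact: mulr_gt0.
    by rewrite -natr1; ring.
  have := gf _ _ _ _ ex; rewrite /furuta_mean.
  rewrite mul0r (op_power0 pA) mul1r mulr1 add0r (op_powerM _ _ pB) mulr1.
  pose Z := A `^^ (r / 2) * B `^^ (n%:R * r) * A `^^ (r / 2); rewrite -/Z => AZ.
  have pAr := posdef_power (r / 2) pA; have pBr := posdef_power (n%:R * r) pB.
  have pZ : posdef Z by exact: posdef_conj.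
  have ZV : Z `^^ (-1) =
      A `^^ (- (1 / 2) * r) * B `^^ (- n%:R * r) * A `^^ (- (1 / 2) * r).
    rewrite (inverse_conj pAr pBr) (op_powerM _ _ pA) (op_powerM _ _ pB).
    by congr (_ `^^ _ * _ `^^ _ * _ `^^ _); ring.
  rewrite -ZV mul1r.
  have := positiveD (positiveZ (ltW N0) AZ) (power_bernoulli n pZ).
  by rewrite scalerBr -/N !addrA subrK.
pose LA := cfc (@ln R) A; pose LB := cfc (@ln R) B.
have fo := first_orderM (first_orderM (first_order_power (- (1 / 2)) pA)
  (first_order_power (- n%:R) pB)) (first_order_power (- (1 / 2)) pA).
have [d d0 [C C0 dC]] := fo.
have [d' d'0 [C' C'0 d'C]] := first_order_power 1 pA.
rewrite -/LA -/LB in dC d'C *; clearbody LA LB.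
apply: positive_closed => e e0.
(* The combined remainder is at most (N C' + C) h^2, and it will be divided by n h. *)
pose K := N * C' + C + 1; have K0 : 0 < K.
  by rewrite ltr_wpDl// addr_ge0// mulr_ge0// ltW.
pose h := Num.min (Num.min d d') (e * n%:R / K).
have h0 : 0 < h by rewrite !lt_min d0 d'0 divr_gt0// mulr_gt0.
have hd : 0 < h <= d by rewrite h0 !ge_min lexx.
have hd' : 0 < h <= d' by rewrite h0 !ge_min lexx orbT.
have he : h * K <= e * n%:R by rewrite -ler_pdivlMr// ge_min lexx orbT.
move: (dC h hd) (d'C h hd') (main h h0).
move: (A `^^ (1 * h)) (_ * _ * A `^^ _) => X F hF hX XF.
have nh : 0 < n%:R * h by rewrite mulr_gt0.
exists ((n%:R * h)^-1%:C *: (N%:C *: X - N%:O - 1 + F)).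
  by apply: positiveZ XF; rewrite invr_ge0 ltW.
have -> : (n%:R * h)^-1%:C *: (N%:C *: X - N%:O - 1 + F) - (LA - LB) =
  (n%:R * h)^-1%:C *: (N%:C *: (X - 1 - h%:C *: (1%:C *: LA)) +
   (F - 1 - h%:C *:
     ((- (1 / 2))%:C *: LA + (- n%:R)%:C *: LB + (- (1 / 2))%:C *: LA))).
  have key (u na a o G nb : operator H) :
      u - o + G - (na - nb) = (u - (na + a)) + (G - o - (- a - nb)).
    rewrite [- a - nb]addrC !opprD !opprK.
    rewrite [G - o + _]addrA [RHS]addrACA subrK.
    by rewrite [- na + nb]addrC !addrA [u - o + G]addrAC.
  have -> : LA - LB =
      (n%:R * h)^-1%:C *: ((n%:R * h)%:C *: LA - (n%:R * h)%:C *: LB).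
    by rewrite -scalerBr scalerA -rmorphM/= mulVf ?gt_eqF// scale1r.
  rewrite -scalerBr; congr (_ *: _).
  rewrite [(- (1 / 2))%:C *: LA + _ + _]addrAC -scalerDl -rmorphD/=.
  rewrite rmorph1 scale1r.
  rewrite !scalerBr.
  rewrite scalerDr !scalerA -!rmorphM/=.
  rewrite (key _ _ (h%:C *: LA)); congr (_ - _ + (_ - (_ + _))).
  - by rewrite -scalerDl -rmorphD/= NE; congr ((_)%:C *: _); ring.
  - by rewrite -scaleNr -rmorphN/=; congr ((_)%:C *: _); field.
  - by rewrite -scaleNr -rmorphN/=; congr ((_)%:C *: _); ring.
apply: le_trans (opnormZ_le _ _) _.
rewrite gtr0_norm ?invr_gt0// ler_pdivrMl//.
apply: le_trans (opnormD _ _) _.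
apply: le_trans (lerD (opnormZ_le _ _) hF) _; rewrite (gtr0_norm N0).
apply: le_trans (lerD (ler_wpM2l (ltW N0) hX) (lexx _)) _.
have := ler_wpM2l (ltW h0) he; rewrite /K.
nra.
Qed.

End Characterizations.

(** * The operator equations and their solutions *)

Section Equations.
Local Notation "X `^^ a" := (opow X a) : ring_scope.
Context {R : realType} {H : hilbertType R}.
Implicit Types (x y z : H) (a b c d e h k p r t s : R)
  (S T X Y Z C D G A B K L Q V W : operator H).
Implicit Types n : nat.

Lemma conj_alternating V T n :
  V * ((T * (V * V)) ^+ n * T) * V = (V * T * V) ^+ n.+1.
Proof.
elim: n => [|n IH]; first by rewrite expr0 mul1r expr1.
by rewrite [in RHS]exprS -IH exprS !mulrA.
Qed.

(** This identifies the two forms of the equation displayed in (D4), and likewise in (D5). *)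
Lemma alternating_swap T K n : (T * K) ^+ n * T = T * (K * T) ^+ n.
Proof.
elim: n => [|n IH]; first by rewrite !expr0 mul1r mulr1.
by rewrite [in RHS]exprSr [RHS]mulrA -IH exprSr !mulrA.
Qed.

Lemma power_root n X : posdef X -> (X ^+ n.+1) `^^ (n.+1%:R^-1) = X.
Proof.
move=> pX; rewrite -(op_power_nat _ pX) (op_powerM _ _ pX) divff ?pnatr_eq0//.
exact: op_power1.
Qed.

Lemma root_power n X : posdef X -> (X `^^ (n.+1%:R^-1)) ^+ n.+1 = X.
Proof.
move=> pX; rewrite -(op_power_nat _ (posdef_power _ pX)) (op_powerM _ _ pX).
by rewrite mulVf ?pnatr_eq0//; exact: op_power1.
Qed.

Lemma posdefX n X : posdef X -> posdef (X ^+ n).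
Proof. by move=> pX; rewrite -(op_power_nat _ pX); exact: posdef_power. Qed.

Lemma conjK V V' X : V * V' = 1 -> V' * V = 1 -> V' * (V * X * V) * V' = X.
Proof. by move=> VV' V'V; rewrite !mulrA V'V mul1r -mulrA VV' mulr1. Qed.

Lemma op_powerVM A a : posdef A ->
  A `^^ a * A `^^ (- a) = 1 /\ A `^^ (- a) * A `^^ a = 1.
Proof. by move=> pA; split; [exact: op_powerVN|exact: op_powerN]. Qed.

(** With U = A^(t/2), E = A^(r/2) and V = E U = U E, the equation says (U B^p U)^s = U W U, where W
    = (T V^2)^n T. Conjugating by E gives (V T V)^(n+1) by [conj_alternating], and the root of order
    n + 1 leaves V T V; every step is reversible. *)
Lemma operator_equation n p r t s A B T :
  posdef A -> posdef B -> posdef T -> s != 0 ->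
  B `^^ p = A `^^ (- (t / 2)) *
     (A `^^ (t / 2) * (T * A `^^ (t + r)) ^+ n * T * A `^^ (t / 2)) `^^ (s^-1) *
     A `^^ (- (t / 2)) <->
  A `^^ ((t + r) / 2) * T * A `^^ ((t + r) / 2) = furuta_mean n p r t s A B.
Proof.
move=> pA pB pT s0; rewrite /furuta_mean.
have pU := posdef_power (t / 2) pA.
have [UU' U'U] := op_powerVM (t / 2) pA.
have pE := posdef_power (r / 2) pA; have [EE' E'E] := op_powerVM (r / 2) pA.
have pV := posdef_power ((t + r) / 2) pA.
have [VV' V'V] := op_powerVM ((t + r) / 2) pA.
have pV' := posdef_power (- ((t + r) / 2)) pA.
have VV : A `^^ ((t + r) / 2) * A `^^ ((t + r) / 2) = A `^^ (t + r).
  by rewrite -(op_powerD _ _ pA) -splitr.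
have EU : A `^^ (r / 2) * A `^^ (t / 2) = A `^^ ((t + r) / 2).
  by rewrite -(op_powerD _ _ pA); congr (_ `^^ _); lra.
have UE : A `^^ (t / 2) * A `^^ (r / 2) = A `^^ ((t + r) / 2).
  by rewrite -(op_powerD _ _ pA); congr (_ `^^ _); lra.
have pBp := posdef_power p pB.
rewrite -VV; clear VV.
move: (A `^^ (t / 2)) (A `^^ (- (t / 2))) (A `^^ (r / 2)) (A `^^ (- (r / 2)))
  (A `^^ ((t + r) / 2)) (A `^^ (- ((t + r) / 2))) (B `^^ p) pU UU' U'U pE EE' E'E
  pV pV' VV' V'V EU UE pBp.
move=> U U' E E' V V' P pU UU' U'U pE EE' E'E pV pV' VV' V'V EU UE pP.
rewrite -[U * _ * T]mulrA.
have VWV := conj_alternating V T n; move: VWV.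
move: ((T * (V * V)) ^+ n * T) => W VWV.
have pVTV : posdef (V * T * V) by exact: posdef_conj.
have pW : posdef W.
  rewrite -(conjK W VV' V'V) VWV; exact: posdef_conj pV' (posdefX _ pVTV).
have pUWU : posdef (U * W * U) by exact: posdef_conj.
have pUPU : posdef (U * P * U) by exact: posdef_conj.
have pQ := posdef_power s pUPU.
have EUWUE : E * (U * W * U) * E = (V * T * V) ^+ n.+1.
  by rewrite -VWV -{1}EU -UE !mulrA.
split=> [PE|VTV].
  have UPU : U * P * U = (U * W * U) `^^ (s^-1) by rewrite PE conjK.
  rewrite UPU (op_powerM _ _ pUWU) mulVf// op_power1//.
  by rewrite EUWUE power_root.
have : (V * T * V) ^+ n.+1 = E * (U * P * U) `^^ s * E.
  by rewrite VTV root_power//; exact: posdef_conj.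
rewrite -EUWUE => /(congr1 (fun X => E' * X * E')).
rewrite !conjK// => ->.
by rewrite (op_powerM _ _ pUPU) divff// op_power1// conjK.
Qed.

Lemma opnorm_le1P T : posdef T -> opnorm T <= 1 <-> positive (1 - T).
Proof.
move=> pT; have sT := posdef_selfadjoint pT.
split=> h.
  by have := positive_opnorm sT h; rewrite rmorph1 scale1r.
apply: (opnorm_le_positive sT ler01); rewrite rmorph1 scale1r//.
exact: positiveD (proj1 pT) positive1.
Qed.

Lemma posdef_furuta_mean n p r t s A B : posdef A -> posdef B ->
  posdef (furuta_mean n p r t s A B).
Proof. by move=> pA pB; apply: posdef_power; exact: posdef_outer_power. Qed.

Definition is_solution n p r t s A B T :=
  B `^^ p = A `^^ (- (t / 2)) *
     (A `^^ (t / 2) * (T * A `^^ (t + r)) ^+ n * T * A `^^ (t / 2)) `^^ (s^-1) *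
     A `^^ (- (t / 2)) /\
  B `^^ p = A `^^ (- (t / 2)) *
     (A `^^ (t / 2) * T * (A `^^ (t + r) * T) ^+ n * A `^^ (t / 2)) `^^ (s^-1) *
     A `^^ (- (t / 2)).

Lemma is_solutionP n p r t s A B T :
  posdef A -> posdef B -> posdef T -> s != 0 ->
  is_solution n p r t s A B T <->
  A `^^ ((t + r) / 2) * T * A `^^ ((t + r) / 2) = furuta_mean n p r t s A B.
Proof.
move=> pA pB pT s0; rewrite -operator_equation// /is_solution.
by rewrite -[_ * T * (_ * T) ^+ n]mulrA -alternating_swap !mulrA; split=> [[]|].
Qed.

Lemma exists_solution n p r t s A B : posdef A -> posdef B -> s != 0 ->
  exists2 T, posdef T & is_solution n p r t s A B T.
Proof.
move=> pA pB s0; have [VV' V'V] := op_powerVM ((t + r) / 2) pA.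
have pV' := posdef_power (- ((t + r) / 2)) pA.
have pG := posdef_furuta_mean n p r t s pA pB.
have pT := posdef_conj pV' pG; exists (A `^^ (- ((t + r) / 2)) *
  furuta_mean n p r t s A B * A `^^ (- ((t + r) / 2))) => //.
by apply/is_solutionP => //; exact: conjK.
Qed.

Lemma solution_unique n p r t s A B S T : posdef A -> posdef B -> s != 0 ->
  posdef S -> posdef T -> is_solution n p r t s A B S ->
  is_solution n p r t s A B T -> S = T.
Proof.
move=> pA pB s0 pS pT /(is_solutionP _ _ _ _ pA pB pS s0) eS.
move=> /(is_solutionP _ _ _ _ pA pB pT s0) eT.
have [VV' V'V] := op_powerVM ((t + r) / 2) pA.
by rewrite -(conjK S VV' V'V) eS -eT conjK.
Qed.

Lemma solution_le1 n p r t s A B T : posdef A -> posdef B -> s != 0 ->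
  posdef T -> is_solution n p r t s A B T ->
  positive (1 - T) <-> positive (A `^^ (t + r) - furuta_mean n p r t s A B).
Proof.
move=> pA pB s0 pT /(is_solutionP _ _ _ _ pA pB pT s0) <-.
have [VV' V'V] := op_powerVM ((t + r) / 2) pA.
have sV := power_selfadjoint ((t + r) / 2) pA.
have sV' := power_selfadjoint (- ((t + r) / 2)) pA.
have -> : A `^^ (t + r) = A `^^ ((t + r) / 2) * 1 * A `^^ ((t + r) / 2).
  by rewrite mulr1 -(op_powerD _ _ pA) -splitr.
by split=> [/(ge_conj sV)//|/(ge_conj sV')]; rewrite !conjK.
Qed.

Lemma solution_ge1 n p r t s A B T : posdef A -> posdef B -> s != 0 ->
  posdef T -> is_solution n p r t s A B T ->
  positive (T - 1) <-> positive (furuta_mean n p r t s A B - A `^^ (t + r)).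
Proof.
move=> pA pB s0 pT /(is_solutionP _ _ _ _ pA pB pT s0) <-.
have [VV' V'V] := op_powerVM ((t + r) / 2) pA.
have sV := power_selfadjoint ((t + r) / 2) pA.
have sV' := power_selfadjoint (- ((t + r) / 2)) pA.
have -> : A `^^ (t + r) = A `^^ ((t + r) / 2) * 1 * A `^^ ((t + r) / 2).
  by rewrite mulr1 -(op_powerD _ _ pA) -splitr.
by split=> [/(ge_conj sV)//|/(ge_conj sV')]; rewrite !conjK.
Qed.

Lemma inverseK T : posdef T -> (T `^^ (-1)) `^^ (-1) = T.
Proof. by move=> pT; rewrite (op_powerM _ _ pT) mulrNN mulr1 op_power1. Qed.

Lemma inverse_le1 T : posdef T ->
  positive (1 - T) <-> positive (T `^^ (-1) - 1).
Proof.
move=> pT; have pTV := posdef_power (-1) pT.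
have p1 : posdef (1 : operator H) by rewrite -(op_power0 pT); exact: posdef_power.
have e1 : (1 : operator H) `^^ (-1) = 1.
  by rewrite -{1}(op_power0 pT) (op_powerM _ _ pT) mul0r op_power0.
split=> h; first by have := inverse_antitone p1 pT h; rewrite e1.
by have := inverse_antitone pTV p1 h; rewrite e1 inverseK.
Qed.

(** A positive definite solution always exists and is unique without the norm condition, so all the
    content lies in |T| <= 1. *)
Lemma contractive_solutionP n p r t s A B : posdef A -> posdef B -> s != 0 ->
  (exists! T, [/\ posdef T, opnorm T <= 1 & is_solution n p r t s A B T]) <->
  positive (A `^^ (t + r) - furuta_mean n p r t s A B).
Proof.
move=> pA pB s0; split=> [[T [[pT T1 eT] _]]|h].
  by apply/(solution_le1 pA pB s0 pT eT)/opnorm_le1P.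
have [T pT eT] := exists_solution n p r t pA pB s0.
exists T; split=> [|S [pS _ eS]].
  by split=> //; apply/opnorm_le1P/(solution_le1 pA pB s0 pT eT).
exact: solution_unique pA pB s0 pT pS eT eS.
Qed.

(** The inverse of T is the unique solution X, and |T| <= 1 amounts to X >= 1; this reverses the
    inequality of the contractive case. *)
Lemma expansive_solutionP n p r t s A B : posdef A -> posdef B -> s != 0 ->
  (exists! T, [/\ posdef T, opnorm T <= 1 &
     is_solution n p r t s A B (T `^^ (-1))]) <->
  positive (furuta_mean n p r t s A B - A `^^ (t + r)).
Proof.
move=> pA pB s0; split=> [[T [[pT T1 eT] _]]|h].
  apply/(solution_ge1 pA pB s0 (posdef_power _ pT) eT)/inverse_le1 => //.
  exact/opnorm_le1P.
have [X pX eX] := exists_solution n p r t pA pB s0.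
have pT := posdef_power (-1) pX.
exists (X `^^ (-1)); split=> [|S [pS _ eS]]; last first.
  have pS' := posdef_power (-1) pS.
  by rewrite (solution_unique pA pB s0 pX pS' eX eS) inverseK.
rewrite inverseK//; split=> //; apply/(opnorm_le1P pT)/(inverse_le1 pT).
by rewrite inverseK//; apply/(solution_ge1 pA pB s0 pX eX).
Qed.

(** Inversion commutes with powers and with conjugation once the conjugating operator is inverted
    too. *)
Lemma furuta_mean_inverse n p r t s A B : posdef A -> posdef B ->
  furuta_mean n p r t s (A `^^ (-1)) (B `^^ (-1)) =
  furuta_mean n p r t s A B `^^ (-1).
Proof.
move=> pA pB; rewrite /furuta_mean.
have pE := posdef_power (r / 2) pA; have pU := posdef_power (t / 2) pA.
have pP := posdef_power p pB; have pQ := posdef_inner_power t p pA pB.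
rewrite (op_powerM _ _ (posdef_outer_power p r t s pA pB)).
rewrite [n.+1%:R^-1 * -1]mulrC.
rewrite -(op_powerM _ _ (posdef_outer_power p r t s pA pB)).
rewrite (inverse_conj pE (posdef_power s pQ)) (op_powerM _ _ pQ).
rewrite [s * -1]mulrC -(op_powerM _ _ pQ) (inverse_conj pU pP).
have swap X a : posdef X -> (X `^^ (-1)) `^^ a = (X `^^ a) `^^ (-1).
  by move=> pX; rewrite !(op_powerM _ _ pX) mulrC.
by rewrite !(swap A)// (swap B).
Qed.

Lemma grand_furuta_inverse n A B : posdef A -> posdef B ->
  grand_furuta n (B `^^ (-1)) (A `^^ (-1)) <->
  forall p r t s : R, exponents n p r t s ->
    positive (furuta_mean n p r t s B A - B `^^ (t + r)).
Proof.
move=> pA pB.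
have swap a : (B `^^ (-1)) `^^ a = (B `^^ a) `^^ (-1).
  by rewrite !(op_powerM _ _ pB) mulrC.
split=> gf p r t s ex.
  have := gf p r t s ex; rewrite furuta_mean_inverse// swap.
  have pF := posdef_furuta_mean n p r t s pB pA.
  have pBtr := posdef_power (t + r) pB.
  move=> /(inverse_antitone (posdef_power _ pBtr) (posdef_power _ pF)).
  by rewrite !inverseK.
rewrite furuta_mean_inverse// swap; apply: inverse_antitone.
- exact: posdef_furuta_mean.
- exact: posdef_power.
- exact: gf.
Qed.

End Equations.

(** * Translation to the notions of the statement *)

Section Statement.
Local Notation "X `^^ a" := (opow X a) : ring_scope.
Context {R : realType} {H : hilbertType R}.
Implicit Types (X Y S T : operator H).

Lemma op_power_opow : @op_power R H = @opow R H.
Proof. by rewrite opow.unlock. Qed.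

Lemma posdef_op_ge X Y : posdef X -> posdef Y -> op_ge X Y <-> positive (X - Y).
Proof.
by move=> pX pY; split=> [[]//|h]; split=> //; exact: posdef_selfadjoint.
Qed.

(** Allows the clauses under [exists!] to be regrouped into [is_solution], and [opinv T] to be
    replaced by a power, which needs [posdef T] from the same conjunction. *)
Lemma exists_unique_iff {U : Type} {P Q : U -> Prop} :
  (forall u, P u <-> Q u) -> (exists! u, P u) <-> (exists! u, Q u).
Proof.
by move=> PQ; have -> : P = Q by apply/funext => u; apply/propext.
Qed.

Lemma chaotic_geV X Y : posdef X -> posdef Y ->
  chaotic_ge X Y <-> chaotic_ge (Y `^^ (-1)) (X `^^ (-1)).
Proof.
move=> pX pY.
have pXV := posdef_power (-1) pX; have pYV := posdef_power (-1) pY.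
rewrite (chaotic_geP pX pY) (chaotic_geP pYV pXV).
rewrite (cfc_ln_inverse pX) (cfc_ln_inverse pY) opprK [- _ + _]addrC.
by split; exact.
Qed.

Lemma chaotic_ge_grand_furuta n X Y : (1 <= n)%N -> posdef X -> posdef Y ->
  chaotic_ge X Y <-> grand_furuta n X Y.
Proof.
move=> n1 pX pY; rewrite chaotic_geP//.
by split; [exact: chaotic_grand_furuta|exact: grand_furuta_chaotic].
Qed.

End Statement.

Theorem theorem2p2 (R : realType) (H : hilbertType R) (A B : operator H)
    (hA : posdef A) (hB : posdef B) (n : nat) (hn : (1 <= n)%N) :
  [<->
    (* D1 *)
    chaotic_ge A B;
    (* D2 *)
    forall p r t s : R, exponents n p r t s ->
      op_ge (A `^^ (t + r))
        ((A `^^ (r / 2) * (A `^^ (t / 2) * B `^^ p * A `^^ (t / 2)) `^^ s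
            * A `^^ (r / 2)) `^^ (n.+1%:R^-1));
    (* D3 *)
    forall p r t s : R, exponents n p r t s ->
      op_ge
        ((B `^^ (r / 2) * (B `^^ (t / 2) * A `^^ p * B `^^ (t / 2)) `^^ s
            * B `^^ (r / 2)) `^^ (n.+1%:R^-1))
        (B `^^ (t + r));
    (* D4 *)
    forall p r t s : R, exponents n p r t s ->
      exists! T : operator H,
        [/\ posdef T, opnorm T <= 1,
            B `^^ p
            = A `^^ (- (t / 2))
              * (A `^^ (t / 2) * (T * A `^^ (t + r)) ^+ n * T
                   * A `^^ (t / 2)) `^^ (s^-1)
              * A `^^ (- (t / 2))
          & B `^^ p
            = A `^^ (- (t / 2))
              * (A `^^ (t / 2) * T * (A `^^ (t + r) * T) ^+ n
                   * A `^^ (t / 2)) `^^ (s^-1)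
              * A `^^ (- (t / 2))];
    (* D5 *)
    forall p r t s : R, exponents n p r t s ->
      exists! T : operator H,
        [/\ posdef T, opnorm T <= 1,
            A `^^ p
            = B `^^ (- (t / 2))
              * (B `^^ (t / 2) * (opinv T * B `^^ (t + r)) ^+ n * opinv T
                   * B `^^ (t / 2)) `^^ (s^-1)
              * B `^^ (- (t / 2))
          & A `^^ p
            = B `^^ (- (t / 2))
              * (B `^^ (t / 2) * opinv T * (B `^^ (t + r) * opinv T) ^+ n
                   * B `^^ (t / 2)) `^^ (s^-1)
              * B `^^ (- (t / 2))]
  ].
Proof.
rewrite op_power_opow.
have s_neq0 (p r t s : R) : exponents n p r t s -> s != 0.
  by move=> ex; rewrite gt_eqF// (exponents_s_gt0 hn ex).
have pA a := posdef_power a hA; have pB a := posdef_power a hB.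
have D2P := chaotic_ge_grand_furuta hn hA hB.
have D3P : chaotic_ge A B <-> forall p r t s : R, exponents n p r t s ->
    positive (furuta_mean n p r t s B A - opow B (t + r)).
  by rewrite (chaotic_geV hA hB) (chaotic_ge_grand_furuta hn)//
    grand_furuta_inverse.
(* Each of the other assertions is tied to (D1) through [D2P] or [D3P], so the middle implications
   of the cycle pass through (D1). *)
tfae.
- move=> /D2P gf p r t s ex; apply/posdef_op_ge; [exact: pA| |exact: gf].
  exact: posdef_furuta_mean.
- move=> d2 p r t s ex; apply/posdef_op_ge; [|exact: pB|].
    exact: posdef_furuta_mean.
  by apply: (proj1 D3P) => //; apply/D2P => p' r' t' s' /d2[].
- move=> d3 p r t s ex.
  apply/(exists_unique_iff (Q := fun T => [/\ posdef T, opnorm T <= 1 &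
    is_solution n p r t s A B T])).
    by move=> T; split=> [[? ? ? ?]|[? ? []]].
  apply: (proj2 (contractive_solutionP n p r t hA hB (s_neq0 _ _ _ _ ex))).
  by apply: (proj1 D2P) => //; apply/D3P => p' r' t' s' /d3[].
- move=> d4 p r t s ex.
  apply/(exists_unique_iff (Q := fun T => [/\ posdef T, opnorm T <= 1 &
    is_solution n p r t s B A (opow T (-1))])).
    move=> T; split=> [[pT T1]|[pT T1 []]]; rewrite (opinv_power pT) => e1 e2;
      by split.
  apply: (proj2 (expansive_solutionP n p r t hB hA (s_neq0 _ _ _ _ ex))).
  apply: (proj1 D3P) => //; apply/D2P => p' r' t' s' ex'.
  apply: (proj1 (contractive_solutionP n p' r' t' hA hB (s_neq0 _ _ _ _ ex'))).
  have := d4 p' r' t' s' ex'.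
  apply: (proj1 (exists_unique_iff _)) => T.
  by split=> [[? ? ? ?]|[? ? []]].
- move=> d5; apply/D3P => p r t s ex.
  apply: (proj1 (expansive_solutionP n p r t hB hA (s_neq0 _ _ _ _ ex))).
  have := d5 p r t s ex.
  apply: (proj1 (exists_unique_iff _)) => T.
  split=> [[pT T1]|[pT T1 []]]; rewrite (opinv_power pT) => e1 e2; by split.
Qed.
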